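(* Let $n\in\{3,4\}$, let $\mathfrak B=\mathfrak B(X,q)$ be a finite-dimensional Nichols algebra over $\mathbb S_n$, i.e. one of $\mathfrak B(\mathcal O_2^3,-1)$ ($n=3$), $\mathfrak B(\mathcal O_2^4,-1)$, $\mathfrak B(\mathcal O_2^4,\chi)$, $\mathfrak B(\mathcal O_4^4,-1)$ ($n=4$), and let $\mathcal H=\mathfrak B\#\Bbbk\mathbb S_n$. Let $\mathcal K$ be a homogeneous left coideal subalgebra of $\mathcal H$ contained in $\mathfrak B\#1$. Then $\mathcal K$ is generated in degree one. In particular, $\mathcal K=\mathcal K_Y$ for a unique subset $Y\subseteq X$.
   Context: $\Bbbk$ is an algebraically closed field of characteristic zero. $\mathcal O_j^n$ is the conjugacy class of $j$-cycles in $\mathbb S_n$, a rack via $i\rhd j=iji^{-1}$. $\mathbb S_n$ acts on $X$ by conjugation, and $g_i=i$ for $i\in X$. Put $\chi_i(t)=\operatorname{sgn}(t)$ when the cocycle is $q\equiv-1$; when $q=\chi$, for $i=(a\,b)$ with $a<b$, $\chi_i(t)=1$ if $t(a)<t(b)$ and $-1$ if $t(a)>t(b)$. In all cases $q_{ij}=\chi_j(g_i)$. $\Bbbk X$ is the Yetter–Drinfeld module over $\mathbb S_n$ with basis $\{x_i\}_{i\in X}$, coaction $\delta(x_i)=g_i\otimes x_i$, action $t\cdot x_i=\chi_i(t)x_{t\cdot i}$, and braiding $c(x_i\otimes x_j)=q_{ij}x_{i\rhd j}\otimes x_i$; $\mathfrak B(X,q)$ is its Nichols algebra (in these cases it coincides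 with its quadratic approximation). $\mathcal H=\mathfrak B\#\Bbbk\mathbb S_n$ is graded by the grading of $\mathfrak B$. A left coideal subalgebra $\mathcal K\subseteq\mathcal H$ is homogeneous if $\mathcal K=\bigoplus\mathcal K(m)$ is a graded algebra with $\mathcal K(m)\subseteq\mathcal H(m)$ and $\Delta(\mathcal K(m))\subseteq\bigoplus_{i=0}^m\mathcal H(i)\otimes\mathcal K(m-i)$. For $Y\subseteq X$, $\mathcal K_Y$ is the subalgebra of $\mathfrak B\#1$ generated by $x_i$, $i\in Y$. *)

(* Defs.v *)
From HB Require Import structures.
From mathcomp Require Import all_boot all_order all_algebra all_fingroup.
From mathcomp Require Import generic_quotient ring_quotient.
From mathcomp Require Import finmap monalg.
From mathcomp Require Import boolp classical_sets.

Set Implicit Arguments.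
Unset Strict Implicit.
Unset Printing Implicit Defensive.

Import GRing.Theory.
Local Open Scope ring_scope.
Local Open Scope quotient_scope.

Lemma lin0 (k : fieldType) (V W : lmodType k) (f : V -> W) : linear f -> f 0 = 0.
Proof.
by move=> lf; have /= := lf (-1) 0 0; rewrite scaler0 addr0 scaleN1r addNr.
Qed.

Section Span.
Variables (k : fieldType) (V : lmodType k).

Inductive span (S : set V) : set V :=
| span0 : span S 0
| spanS c v w : S v -> span S w -> span S (c *: v + w).

Lemma span_incl S v : S v -> span S v.
Proof.
by move=> Sv; rewrite -[v]scale1r -[_ *: _]addr0; apply: spanS => //; left.
Qed.

Lemma span_lin S c u v : span S u -> span S v -> span S (c *: u + v).
Proof.
move=> Su Sv; elim: Su => [|d x y Sx _ IH]; first by rewrite scaler0 add0r.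
by rewrite scalerDr scalerA -addrA; apply: spanS.
Qed.

Lemma spanD S u v : span S u -> span S v -> span S (u + v).
Proof. by rewrite -{2}[u]scale1r; exact: span_lin. Qed.

Lemma spanZ S c u : span S u -> span S (c *: u).
Proof. by move=> Su; rewrite -[_ *: _]addr0; apply: span_lin => //; left. Qed.

Lemma spanB S u v : span S u -> span S v -> span S (u - v).
Proof. by move=> Su Sv; apply: spanD => //; rewrite -scaleN1r; exact: spanZ. Qed.

Definition spanb (S : set V) : {pred V} := fun v => `[< span S v >].

Lemma spanb_zmod S : zmod_closed (spanb S).
Proof.
split; first by apply/asboolP; left.
by move=> u v /asboolP Su /asboolP Sv; apply/asboolP; exact: spanB.
Qed.
HB.instance Definition _ S := GRing.isZmodClosed.Build V (spanb S) (spanb_zmod S).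

Definition lquot (S : set V) : Type := Quotient.quot (spanb S).
HB.instance Definition _ S := GRing.Zmodule.on (lquot S).

Definition lproj (S : set V) (v : V) : lquot S := \pi_(Quotient.quot (spanb S)) v.
Definition lrepr (S : set V) (x : lquot S) : V := repr (x : Quotient.quot (spanb S)).

Lemma lreprK S : cancel (@lrepr S) (@lproj S).
Proof. exact: reprK. Qed.

Lemma lproj_eq S u v : lproj S u = lproj S v <-> span S (u - v).
Proof.
split => [/eqP h|h]; last apply/eqP; rewrite ?/lproj -Quotient.idealrBE in h *.
  exact/asboolP.
exact/asboolP.
Qed.

Lemma lprojD S u v : lproj S (u + v) = lproj S u + lproj S v.
Proof. by rewrite /lproj !piE. Qed.

Lemma lproj0 S : lproj S 0 = 0.
Proof. by rewrite /lproj !piE. Qed.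

Lemma lproj_eq0 S u : lproj S u = 0 <-> span S u.
Proof. by rewrite -(lproj0 S) lproj_eq subr0. Qed.

Lemma lrepr_proj S v : span S (lrepr (lproj S v) - v).
Proof. by apply/lproj_eq; rewrite lreprK. Qed.

Definition lquot_scale (S : set V) (c : k) (x : lquot S) : lquot S :=
  lproj S (c *: lrepr x).

Lemma lproj_scale S c v : lquot_scale c (lproj S v) = lproj S (c *: v).
Proof. by apply/lproj_eq; rewrite -scalerBr; apply/spanZ/lrepr_proj. Qed.

Lemma lquot_scalerA S a b (x : lquot S) :
  lquot_scale a (lquot_scale b x) = lquot_scale (a * b) x.
Proof. by rewrite -[x]lreprK !lproj_scale scalerA. Qed.
Lemma lquot_scale1r S : left_id 1 (@lquot_scale S).
Proof. by move=> x; rewrite -[x]lreprK !lproj_scale scale1r. Qed.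
Lemma lquot_scalerDr S : right_distributive (@lquot_scale S) +%R.
Proof.
by move=> a x y; rewrite -[x]lreprK -[y]lreprK -lprojD !lproj_scale scalerDr lprojD.
Qed.
Lemma lquot_scalerDl S (x : lquot S) :
  {morph (@lquot_scale S)^~ x : a b / a + b}.
Proof. by move=> a b; rewrite -[x]lreprK !lproj_scale scalerDl lprojD. Qed.
HB.instance Definition _ S := GRing.Zmodule_isLmodule.Build k (lquot S)
  (@lquot_scalerA S) (@lquot_scale1r S) (@lquot_scalerDr S) (@lquot_scalerDl S).

Lemma lproj_linear S : linear (@lproj S).
Proof. by move=> c u v; rewrite lprojD -lproj_scale. Qed.
HB.instance Definition _ S := GRing.isLinear.Build k V (lquot S) _ (lproj S)
  (@lproj_linear S).

Definition qlift (S : set V) (W : Type) (f : V -> W) (x : lquot S) : W :=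
  f (lrepr x).

Lemma qliftE (S : set V) (W : lmodType k) (f : V -> W) v :
  linear f -> (forall u, S u -> f u = 0) -> qlift f (lproj S v) = f v.
Proof.
move=> lf f0.
have fS u : span S u -> f u = 0.
  by elim=> [|c]; first exact: lin0; move=>  x y Sx _ fy; rewrite lf f0 // fy scaler0 addr0.
have -> : f v = 1 *: f v + 0 by rewrite scale1r addr0.
rewrite -(fS _ (lrepr_proj S v)) -lf scale1r; congr f.
by rewrite addrC subrK.
Qed.

End Span.

(* The operations of fmod are locked copies of those of malg, for which *)
(* failing unification problems are prohibitively slow.                 *)
Record fmod (k : fieldType) (I : choiceType) :=
  Fmod { fval : {malg k[I]} }.
HB.instance Definition _ k I := [isNew for @fval k I].
HB.instance Definition _ k I := [Choice of fmod k I by <:].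

HB.lock Definition fadd (k : fieldType) (I : choiceType) (a b : fmod k I) : fmod k I := Fmod (fval a + fval b).
HB.lock Definition fopp (k : fieldType) (I : choiceType) (a : fmod k I) : fmod k I := Fmod (- fval a).
HB.lock Definition fzero (k : fieldType) (I : choiceType) : fmod k I := Fmod 0.
HB.lock Definition fscale (k : fieldType) (I : choiceType) (c : k) (a : fmod k I) : fmod k I := Fmod (c *: fval a).
HB.lock Definition fbas (k : fieldType) (I : choiceType) (i : I) : fmod k I := Fmod << i >>.
HB.lock Definition fone (k : fieldType) (M : monomType) : fmod k M := Fmod 1.
HB.lock Definition fmul (k : fieldType) (M : monomType) (a b : fmod k M) : fmod k M :=
  Fmod (fval a * fval b).
Arguments fbas {k I} i.

Section FreeModule.
Variables (k : fieldType) (I : choiceType).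
Implicit Types a b : fmod k I.

Lemma fval_inj : injective (@fval k I). Proof. exact: val_inj. Qed.

Lemma faddA : associative (@fadd k I).
Proof. by move=> a b c; apply: fval_inj; rewrite !fadd.unlock /= addrA. Qed.
Lemma faddC : commutative (@fadd k I).
Proof. by move=> a b; apply: fval_inj; rewrite !fadd.unlock /= addrC. Qed.
Lemma fadd0 : left_id (fzero k I) (@fadd k I).
Proof. by move=> a; apply: fval_inj; rewrite fadd.unlock fzero.unlock /= add0r. Qed.
Lemma faddN : left_inverse (fzero k I) (@fopp k I) (@fadd k I).
Proof.
move=> a; apply: fval_inj.
by rewrite fadd.unlock fopp.unlock fzero.unlock /= addNr.
Qed.
HB.instance Definition _ := GRing.isZmodule.Build (fmod k I) faddA faddC fadd0 faddN.

Lemma fvalD a b : fval (a + b) = fval a + fval b.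
Proof. by rewrite /GRing.add /= fadd.unlock. Qed.

Lemma fscaleA c d a : fscale c (fscale d a) = fscale (c * d) a.
Proof. by apply: fval_inj; rewrite !fscale.unlock /= scalerA. Qed.
Lemma fscale1 : left_id 1 (@fscale k I).
Proof. by move=> a; apply: fval_inj; rewrite !fscale.unlock /= scale1r. Qed.
Lemma fscaleDr : right_distributive (@fscale k I) +%R.
Proof.
by move=> c a b; apply: fval_inj; rewrite !fscale.unlock /= !fvalD /= scalerDr.
Qed.
Lemma fscaleDl a : {morph (@fscale k I)^~ a : c d / c + d}.
Proof.
by move=> c d; apply: fval_inj; rewrite !fscale.unlock /= !fvalD /= scalerDl.
Qed.
HB.instance Definition _ := GRing.Zmodule_isLmodule.Build k (fmod k I)
  fscaleA fscale1 fscaleDr fscaleDl.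

Lemma fvalZ c a : fval (c *: a) = c *: fval a.
Proof. by rewrite /GRing.scale /= fscale.unlock. Qed.

Lemma fval0 : fval (0 : fmod k I) = 0.
Proof. by rewrite /GRing.zero /= fzero.unlock. Qed.

Lemma fval_bas i : fval (fbas i) = << i >> :> {malg k[I]}.
Proof. by rewrite fbas.unlock. Qed.

Definition fcoef (i : I) (a : fmod k I) : k := (fval a)@_i.

Lemma fcoefD i a b : fcoef i (a + b) = fcoef i a + fcoef i b.
Proof. by rewrite /fcoef fvalD mcoeffD. Qed.
Lemma fcoefZ i c a : fcoef i (c *: a) = c * fcoef i a.
Proof. by rewrite /fcoef fvalZ mcoeffZ. Qed.
Lemma fcoef0 i : fcoef i 0 = 0.
Proof. by rewrite /fcoef fval0 mcoeff0. Qed.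
Lemma fcoef_bas i j : fcoef i (fbas j) = (j == i)%:R.
Proof. by rewrite /fcoef fval_bas mcoeffU. Qed.
Lemma fmodP a b : (forall i, fcoef i a = fcoef i b) -> a = b.
Proof. by move=> ab; apply/fval_inj/malgP. Qed.

Definition fsupp (a : fmod k I) : seq I := enum_fset (msupp (fval a)).

Variable V : lmodType k.

Definition lext (f : I -> V) (a : fmod k I) : V :=
  \sum_(i <- fsupp a) fcoef i a *: f i.

Lemma lextEw f (d : {fset I}) a : (msupp (fval a) `<=` d)%fset ->
  lext f a = \sum_(i <- d) fcoef i a *: f i.
Proof.
move=> le; rewrite [LHS](big_fset_incl _ le) => //= x xd /mcoeff_outdom.
by rewrite /fcoef => ->; rewrite scale0r.
Qed.

Lemma lext_bas f i : lext f (fbas i) = f i.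
Proof.
rewrite (@lextEw _ [fset i]%fset) ?fval_bas ?msuppU_le // big_seq_fset1.
by rewrite fcoef_bas eqxx scale1r.
Qed.

Lemma lext_linear f : linear (lext f).
Proof.
move=> c u v.
pose d := (msupp (fval u) `|` msupp (fval v))%fset.
have du : (msupp (fval u) `<=` d)%fset := fsubsetUl _ _.
have dv : (msupp (fval v) `<=` d)%fset := fsubsetUr _ _.
have duv : (msupp (fval (c *: u + v)%R) `<=` d)%fset.
  rewrite fvalD fvalZ; apply: fsubset_trans (msuppD_le _ _) _.
  rewrite fsubUset dv andbT; exact: fsubset_trans (msuppZ_le _ _) du.
rewrite (lextEw _ du) (lextEw _ dv) (lextEw _ duv) scaler_sumr -big_split /=.
by apply: eq_bigr => i _; rewrite fcoefD fcoefZ scalerDl scalerA.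
Qed.
HB.instance Definition _ f := GRing.isLinear.Build k (fmod k I) V _ (lext f)
  (@lext_linear f).

Lemma fmod_linear_ext (f g : fmod k I -> V) : linear f -> linear g ->
  (forall i, f (fbas i) = g (fbas i)) -> f =1 g.
Proof.
move=> lf lg fg a.
have -> : a = \sum_(i <- fsupp a) fcoef i a *: fbas i.
  apply: fmodP => j; rewrite /fcoef [in LHS](monalgE (fval a)).
  rewrite (big_morph (@fval k I) fvalD fval0) !raddf_sum /=; apply: eq_bigr => i _.
  by rewrite fvalZ fval_bas mcoeffZ !mcoeffU mulrnAr mulr1.
elim: (fsupp a) => [|i s IH]; first by rewrite big_nil (lin0 lf) (lin0 lg).
by rewrite big_cons lf lg IH fg.
Qed.

End FreeModule.

Section MonoidAlgebra.
Variables (k : fieldType) (M : monomType).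
Implicit Types a b : fmod k M.

Lemma fmulA : associative (@fmul k M).
Proof. by move=> a b c; apply: fval_inj; rewrite !fmul.unlock /= mulrA. Qed.
Lemma fmul1 : left_id (fone k M) (@fmul k M).
Proof. by move=> a; apply: fval_inj; rewrite fmul.unlock fone.unlock /= mul1r. Qed.
Lemma fmulx1 : right_id (fone k M) (@fmul k M).
Proof. by move=> a; apply: fval_inj; rewrite fmul.unlock fone.unlock /= mulr1. Qed.
Lemma fmulDl : left_distributive (@fmul k M) +%R.
Proof.
by move=> a b c; apply: fval_inj; rewrite !fmul.unlock /= !fvalD /= mulrDl.
Qed.
Lemma fmulDr : right_distributive (@fmul k M) +%R.
Proof.
by move=> a b c; apply: fval_inj; rewrite !fmul.unlock /= !fvalD /= mulrDr.
Qed.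
Lemma fone_neq0 : fone k M != 0.
Proof.
apply/eqP => /(congr1 (@fval k M))/eqP.
by rewrite fone.unlock fval0 /= oner_eq0.
Qed.
HB.instance Definition _ := GRing.Zmodule_isNzRing.Build (fmod k M)
  fmulA fmul1 fmulx1 fmulDl fmulDr fone_neq0.

Lemma fvalM a b : fval (a * b) = fval a * fval b.
Proof. by rewrite /GRing.mul /= fmul.unlock. Qed.
Lemma fval1 : fval (1 : fmod k M) = 1.
Proof. by rewrite /GRing.one /= fone.unlock. Qed.

Lemma fscalerAl c a b : c *: (a * b) = (c *: a) * b.
Proof. by apply: fval_inj; rewrite !(fvalZ, fvalM) scalerAl. Qed.
HB.instance Definition _ := GRing.Lmodule_isLalgebra.Build k (fmod k M) fscalerAl.

Lemma fscalerAr c a b : c *: (a * b) = a * (c *: b).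
Proof.
apply: fval_inj; rewrite !(fvalZ, fvalM) -!mul_malgC !mulrA; congr (_ * _).
apply/malgP => w; rewrite mcoeffCM !malgM_def fgmulgU raddf_sum /=.
rewrite [in LHS](monalgE (fval a)) raddf_sum /= mulr_sumr.
by apply: eq_bigr => v _; rewrite mulm1 !mcoeffU mulrnAr mulrC.
Qed.
HB.instance Definition _ := GRing.Lalgebra_isAlgebra.Build k (fmod k M) fscalerAr.

Lemma fbasM (u v : M) : fbas u * fbas v = fbas (mmul u v) :> fmod k M.
Proof. by apply: fval_inj; rewrite fvalM !fval_bas malgM_def fgmulUU mulr1. Qed.

Lemma fbas1 : fbas mone = 1 :> fmod k M.
Proof. by apply: fval_inj; rewrite fval1 fval_bas. Qed.

End MonoidAlgebra.

Section Tensor.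
Variables (k : fieldType) (U W : lmodType k).

(* U (x) W is the free module on U * W modulo the bilinearity relations; for *)
(* bilinear f, [tlift f] is the linear map u (x) w |-> f u w (tlift_tprod). *)
Inductive bilin_rel : set (fmod k (U * W)%type) :=
| bilinl c u u' w : bilin_rel (fbas (c *: u + u', w) - c *: fbas (u, w) - fbas (u', w))
| bilinr c u w w' : bilin_rel (fbas (u, c *: w + w') - c *: fbas (u, w) - fbas (u, w')).

Definition tensor : Type := lquot bilin_rel.
HB.instance Definition _ := GRing.Lmodule.on tensor.

Definition tprod (u : U) (w : W) : tensor := lproj bilin_rel (fbas (u, w)).

Definition tlift (Z : lmodType k) (f : U -> W -> Z) (z : tensor) : Z :=
  qlift (lext (fun p => f p.1 p.2)) z.

Lemma tprod_linl w : linear (tprod^~ w).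
Proof.
move=> c u v; rewrite /tprod -lproj_linear; apply/lproj_eq.
by rewrite opprD addrA; apply/span_incl/bilinl.
Qed.

Lemma tprod_linr u : linear (tprod u).
Proof.
move=> c w v; rewrite /tprod -lproj_linear; apply/lproj_eq.
by rewrite opprD addrA; apply/span_incl/bilinr.
Qed.

Section Lift.
Variables (Z : lmodType k) (f : U -> W -> Z).
Hypothesis fl : forall w, linear (f^~ w).
Hypothesis fr : forall u, linear (f u).

Let tliftE v : tlift f (lproj bilin_rel v) = lext (fun p => f p.1 p.2) v.
Proof.
apply: qliftE; first exact: lext_linear.
by move=> _ [] c ? ? ?; rewrite !linearB linearZ /= !lext_bas /= ?fl ?fr;
  rewrite -addrA -opprD subrr.
Qed.

Lemma tlift_tprod u w : tlift f (tprod u w) = f u w.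
Proof. by rewrite tliftE lext_bas. Qed.

Lemma tlift_linear : linear (tlift f).
Proof.
move=> c x y; rewrite -[x]lreprK -[y]lreprK -lproj_linear !tliftE.
exact: lext_linear.
Qed.
End Lift.

End Tensor.

Lemma span_map (k : fieldType) (V W : lmodType k) (f : V -> W) S S' u :
  linear f -> (forall v, S v -> span S' (f v)) -> span S u -> span S' (f u).
Proof.
move=> lf fS; elim=> [|c v w Sv _ IH]; last by rewrite lf; apply: span_lin (fS _ Sv) IH.
by rewrite (lin0 lf); left.
Qed.

(* Permutations are composed as functions: [pcomp s t] is s after t, whereas *)
(* [(s * t)%g] is t after s, so that [i ^ t] is t i t^-1 in the former.      *)
Definition pcomp (n : nat) (s t : 'S_n) : 'S_n := (t * s)%g.

(* X stable under conjugation with g_i = i, and chi_i(ts) = chi_(s.i)(t) chi_i(s),  *)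
(* so that t . x_i = chi_i(t) x_(t.i), delta(x_i) = i (x) x_i defines a Yetter-Drinfeld *)
(* module V over S_n with braiding c(x_i (x) v) = (i . v) (x) x_i; in particular        *)
(* c(x_i (x) x_j) = chi_j(i) x_(i j i^-1) (x) x_i.                                      *)
Record rack_datum (k : fieldType) (n : nat) := RackDatum {
  rd_set : {set 'S_n};
  rd_chi : 'S_n -> 'S_n -> k;
  rd_conj : forall i t, i \in rd_set -> (i ^ t)%g \in rd_set;
  rd_chi1 : forall i, i \in rd_set -> rd_chi i 1%g = 1;
  rd_chiM : forall i s t, i \in rd_set ->
    rd_chi i (pcomp t s) = rd_chi (i ^ s)%g t * rd_chi i s
}.

Section Nichols.
Variables (k : fieldType) (n : nat) (D : rack_datum k n).

Definition rd_idx : Type := {i : 'S_n | i \in rd_set D}.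
HB.instance Definition _ := Finite.on rd_idx.

Definition iact (t : 'S_n) (i : rd_idx) : rd_idx :=
  exist _ (val i ^ t)%g (rd_conj t (valP i)).

Local Notation talg := (fmod k {fmonom rd_idx}).

Definition tgen (i : rd_idx) : talg := fbas (fmu i).

Definition wact (t : 'S_n) (w : {fmonom rd_idx}) : talg :=
  (\prod_(i <- (w : seq rd_idx)) rd_chi D (val i) t) *: fbas (FMonom (map (iact t) w)).
Definition tact (t : 'S_n) (a : talg) : talg := lext (wact t) a.

(* S_n-degree of a word: delta(x_w) = wdeg w (x) x_w *)
Definition wdeg (w : seq rd_idx) : 'S_n :=
  foldr (fun i g => pcomp (val i) g) 1%g w.

Definition tcomp (P : pred {fmonom rd_idx}) (a : talg) : talg :=
  lext (fun w => if P w then fbas w else 0) a.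
(* delta(a) = \sum_g g (x) tcoact g a *)
Definition tcoact (g : 'S_n) : talg -> talg := tcomp (fun w => wdeg w == g).
Definition thomog (m : nat) : talg -> talg := tcomp (fun w => size w == m).

(* The braided comultiplication of T(V): the algebra map to the braided tensor    *)
(* product, (u (x) v)(u' (x) v') = u c(v (x) u') v', with x_i primitive, whence    *)
(* Delta(x_i w) = (x_i (x) 1 + 1 (x) x_i) Delta(w), (1 (x) x_i)(u (x) v) =          *)
(* (i . u) (x) x_i v.                                                              *)
Fixpoint wcopr (w : seq rd_idx) : tensor talg talg :=
  if w is i :: w' then
    tlift (fun u v : talg => tprod (tgen i * u) v + tprod (tact (val i) u) (tgen i * v))
      (wcopr w')
  else tprod 1 1.
Definition tcopr (a : talg) : tensor talg talg :=
  lext (fun w : {fmonom rd_idx} => wcopr w) a.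

(* Homogeneous two-sided ideals of T(V) generated in degrees >= 2 that are coideals *)
(* and Yetter-Drinfeld submodules; the Nichols algebra is T(V) modulo their sum,     *)
(* which is the largest one (nichols_ideal_cand, nichols_ideal_max).                 *)
Record nichols_cand (I : set talg) : Prop := NicholsCand {
  nc_lin : forall c a b, I a -> I b -> I (c *: a + b);
  nc_mull : forall a b, I b -> I (a * b);
  nc_mulr : forall a b, I a -> I (a * b);
  nc_act : forall t a, I a -> I (tact t a);
  nc_coact : forall g a, I a -> I (tcoact g a);
  nc_homog : forall m a, I a -> I (thomog m a);
  nc_ge2 : forall a w, I a -> (size (w : {fmonom rd_idx}) < 2)%N -> fcoef w a = 0;
  nc_copr : forall a, I a ->
    span [set z | exists u v, (I u \/ I v) /\ z = tprod u v] (tcopr a)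
}.

Definition nichols_gens : set talg := [set a | exists2 I, nichols_cand I & I a].
Definition nichols_ideal : set talg := span nichols_gens.

Let gens_ideal a : nichols_gens a -> nichols_ideal a. Proof. exact: span_incl. Qed.

Lemma tact_linear t : linear (tact t). Proof. exact: lext_linear. Qed.
Lemma tcomp_linear P : linear (tcomp P). Proof. exact: lext_linear. Qed.
Lemma tcopr_linear : linear tcopr. Proof. exact: lext_linear. Qed.

HB.instance Definition _ t := GRing.isLinear.Build k talg talg _ (tact t) (tact_linear t).
HB.instance Definition _ P := GRing.isLinear.Build k talg talg _ (tcomp P) (tcomp_linear P).
HB.instance Definition _ := GRing.isLinear.Build k talg (tensor talg talg) _ tcopr tcopr_linear.

Lemma nichols_ideal_cand : nichols_cand nichols_ideal.
Proof.
split.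
- exact: span_lin.
- move=> a b; apply: (span_map (f := *%R a)) => [c u w|]; first by rewrite mulrDr scalerAr.
  move=> v [I cI Iv].
  by apply: gens_ideal; exists I => //; apply: (nc_mull cI).
- move=> a b; apply: (span_map (f := *%R^~ b)) => [c u w|]; first by rewrite mulrDl scalerAl.
  move=> v [I cI Iv].
  by apply: gens_ideal; exists I => //; apply: (nc_mulr cI).
- move=> t a; apply: (span_map (tact_linear t)) => v [I cI Iv].
  by apply: gens_ideal; exists I => //; apply: (nc_act cI).
- move=> g a; apply: (span_map (tcomp_linear _)) => v [I cI Iv].
  by apply: gens_ideal; exists I => //; apply: (nc_coact cI).
- move=> m a; apply: (span_map (tcomp_linear _)) => v [I cI Iv].
  by apply: gens_ideal; exists I => //; apply: (nc_homog cI).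
- move=> a w Ja w2; elim: Ja => [|c v u [I cI Iv] _ IH]; first by rewrite fcoef0.
  by rewrite fcoefD fcoefZ IH (nc_ge2 cI) // mulr0 addr0.
move=> a; apply: (span_map tcopr_linear) => v [I cI Iv].
have := nc_copr cI Iv.
apply: (span_map (f := fun z => z)) => [c x y //|_ [u [w [Iuw ->]]]].
apply: span_incl; exists u, w; split => //.
by case: Iuw => h; [left|right]; apply: gens_ideal; exists I.
Qed.

Lemma nichols_ideal_max I : nichols_cand I -> (I `<=` nichols_ideal)%classic.
Proof. by move=> cI a Ia; apply: gens_ideal; exists I. Qed.

Definition nichols : Type := lquot nichols_gens.
HB.instance Definition _ := GRing.Lmodule.on nichols.

Definition nproj : talg -> nichols := lproj nichols_gens.

Definition nrepr (x : nichols) : talg := lrepr x.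
Lemma nreprK : cancel nrepr nproj. Proof. exact: lreprK. Qed.

Lemma nproj_linear : linear nproj. Proof. exact: lproj_linear. Qed.
HB.instance Definition _ := GRing.isLinear.Build k talg nichols _ nproj nproj_linear.
Lemma nproj_eq u v : nproj u = nproj v <-> nichols_ideal (u - v).
Proof. exact: lproj_eq. Qed.

Lemma nproj0 u : nichols_ideal u -> nproj u = 0 :> nichols.
Proof. by move/lproj_eq0. Qed.

Definition nmul (x y : nichols) : nichols := nproj (lrepr x * lrepr y).

Lemma nproj_mul u v : nmul (nproj u) (nproj v) = nproj (u * v).
Proof.
have Jr w : nichols_ideal (nrepr (nproj w) - w) by exact: lrepr_proj.
apply/nproj_eq; rewrite -/(nrepr _) -/(nrepr _).
set u' := nrepr (nproj u); set v' := nrepr (nproj v).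
have -> : u' * v' - u * v = (u' - u) * v' + u * (v' - v).
  by rewrite mulrBl mulrBr addrA subrK.
apply: spanD; first exact/(nc_mulr nichols_ideal_cand)/Jr.
exact/(nc_mull nichols_ideal_cand)/Jr.
Qed.

Let nD u v : nproj u + nproj v = nproj (u + v). Proof. by rewrite linearD. Qed.
Let nZ c u : c *: nproj u = nproj (c *: u). Proof. by rewrite linearZ. Qed.

Lemma nmulA : associative nmul.
Proof.
by move=> x y z; rewrite -[x]nreprK -[y]nreprK -[z]nreprK !nproj_mul mulrA.
Qed.
Lemma nmul1x : left_id (nproj 1) nmul.
Proof. by move=> x; rewrite -[x]nreprK !nproj_mul mul1r. Qed.
Lemma nmulx1 : right_id (nproj 1) nmul.
Proof. by move=> x; rewrite -[x]nreprK !nproj_mul mulr1. Qed.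
Lemma nmulDl : left_distributive nmul +%R.
Proof.
by move=> x y z; rewrite -[x]nreprK -[y]nreprK -[z]nreprK !(nD, nproj_mul) mulrDl.
Qed.
Lemma nmulDr : right_distributive nmul +%R.
Proof.
by move=> x y z; rewrite -[x]nreprK -[y]nreprK -[z]nreprK !(nD, nproj_mul) mulrDr.
Qed.
Lemma n1_neq0 : nproj 1 != 0.
Proof.
apply/eqP => /lproj_eq0 J1.
have := nc_ge2 nichols_ideal_cand (w := mone) J1.
by rewrite fm1 -fbas1 fcoef_bas eqxx => /(_ isT)/eqP; rewrite oner_eq0.
Qed.
HB.instance Definition _ := GRing.Zmodule_isNzRing.Build nichols
  nmulA nmul1x nmulx1 nmulDl nmulDr n1_neq0.

Lemma nprojM u v : nproj (u * v) = nproj u * nproj v.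
Proof. by rewrite -nproj_mul. Qed.

Lemma nscalerAl c (x y : nichols) : c *: (x * y) = (c *: x) * y.
Proof.
by rewrite -[x]nreprK -[y]nreprK !(nZ, =^~ nprojM) scalerAl.
Qed.
HB.instance Definition _ := GRing.Lmodule_isLalgebra.Build k nichols nscalerAl.

Lemma nscalerAr c (x y : nichols) : c *: (x * y) = x * (c *: y).
Proof.
rewrite -[x]nreprK -[y]nreprK !(nZ, =^~ nprojM); congr nproj.
exact: scalerAr.
Qed.
HB.instance Definition _ := GRing.Lalgebra_isAlgebra.Build k nichols nscalerAr.

(* The structure maps of T(V) descend to the quotient: see nact_proj, ncoact_proj *)
(* and ncopr_proj for the independence of the representative chosen by qlift.     *)
Definition nact (t : 'S_n) : nichols -> nichols := qlift (fun a => nproj (tact t a)).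
Definition ncoact (g : 'S_n) : nichols -> nichols := qlift (fun a => nproj (tcoact g a)).
Definition ncopr : nichols -> tensor nichols nichols :=
  qlift (fun a => tlift (fun u v : talg => tprod (nproj u) (nproj v)) (tcopr a)).

Lemma nact_proj t a : nact t (nproj a) = nproj (tact t a).
Proof.
apply: qliftE => [c u v|u gu]; first by rewrite tact_linear nproj_linear.
by apply/lproj_eq0/(nc_act nichols_ideal_cand)/gens_ideal.
Qed.

Lemma ncoact_proj g a : ncoact g (nproj a) = nproj (tcoact g a).
Proof.
apply: qliftE => [c u v|u gu]; first by rewrite /tcoact tcomp_linear nproj_linear.
by apply/lproj_eq0/(nc_coact nichols_ideal_cand)/gens_ideal.
Qed.

Lemma ncopr_proj a :
  ncopr (nproj a) = tlift (fun u v : talg => tprod (nproj u) (nproj v)) (tcopr a).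
Proof.
have fl w : linear (fun u : talg => tprod (nproj u) (nproj w)).
  by move=> c u v; rewrite nproj_linear tprod_linl.
have fr u : linear (fun w : talg => tprod (nproj u) (nproj w)).
  by move=> c w v; rewrite nproj_linear tprod_linr.
have lt := tlift_linear fl fr.
apply: qliftE => [c u v|u gu]; first by rewrite tcopr_linear lt.
have := nc_copr nichols_ideal_cand (gens_ideal gu).
elim=> [|c _ z [v [w [Jvw ->]]] _ IH].
  exact: lin0 lt.
rewrite lt IH addr0 (tlift_tprod fl fr).
case: Jvw => /nproj0 ->.
  by rewrite (lin0 (tprod_linl _)) scaler0.
by rewrite (lin0 (tprod_linr _)) scaler0.
Qed.

End Nichols.

Section Action.
Variables (k : fieldType) (n : nat) (D : rack_datum k n).
Local Notation talg := (fmod k {fmonom rd_idx D}).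
Local Notation nichols := (nichols D).

Lemma fmM_cat (u v : {fmonom rd_idx D}) : mmul u v = FMonom (u ++ v) :> {fmonom _}.
Proof. by apply/eqP; rewrite fmP fmM. Qed.

Lemma tact_bas t w : tact t (fbas w) = wact t w :> talg.
Proof. by rewrite /tact lext_bas. Qed.

Lemma tactM t (a b : talg) : tact t (a * b) = tact t a * tact t b.
Proof.
have tl := tact_linear (D := D) t.
move: a; apply: fmod_linear_ext => [||u].
- by move=> c x y; rewrite mulrDl -scalerAl tl.
- by move=> c x y; rewrite tl mulrDl -scalerAl.
move: b; apply: fmod_linear_ext => [||v].
- by move=> c x y; rewrite mulrDr -scalerAr tl.
- by move=> c x y; rewrite tl mulrDr -scalerAr.
rewrite fbasM !tact_bas /wact fmM_cat /= big_cat map_cat -scalerA.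
by rewrite -scalerAl -scalerAr fbasM fmM_cat.
Qed.

Lemma tact_one t : tact t 1 = 1 :> talg.
Proof.
have -> : 1 = fbas (FMonom [::]) :> talg by rewrite -fmoneE fbas1.
by rewrite tact_bas /wact /= big_nil scale1r.
Qed.

Lemma tact1 (a : talg) : tact 1%g a = a.
Proof.
move: a; apply: fmod_linear_ext => [||[w]] //; first exact: tact_linear.
rewrite tact_bas /wact /= big1 ?scale1r; last by move=> i _; rewrite rd_chi1 ?(valP i).
by congr (fbas (FMonom _)); rewrite map_id_in // => i _; apply/val_inj; rewrite /= conjg1.
Qed.

Lemma tact_comp s t (a : talg) : tact (pcomp t s) a = tact t (tact s a).
Proof.
move: a; apply: fmod_linear_ext => [||[w]].
- exact: tact_linear.
- by move=> c x y /=; rewrite !tact_linear.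
rewrite !tact_bas /wact /= linearZ /= tact_bas /wact /= scalerA big_map -big_split /=.
have -> : map (iact (pcomp t s)) w = map (iact t) (map (iact s) w).
  rewrite -map_comp; apply: eq_map => i; apply/val_inj.
  by rewrite /= /pcomp conjgM.
rewrite (eq_bigr (fun i => rd_chi D (val i) s * rd_chi D (val i ^ s)%g t)) //.
by move=> i _; rewrite rd_chiM ?(valP i) // mulrC.
Qed.

Lemma nact_linear t : linear (@nact k n D t).
Proof.
move=> c x y; rewrite -[x]nreprK -[y]nreprK.
move: (nrepr x) (nrepr y) => u v.
rewrite -(nproj_linear (D:=D) c u v) (nact_proj t (c *: u + v)) (nact_proj t u) (nact_proj t v).
by rewrite (tact_linear t c u v) (nproj_linear (D:=D) c (tact t u) (tact t v)).
Qed.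

HB.instance Definition _ t := GRing.isLinear.Build k nichols nichols _ (@nact k n D t)
  (@nact_linear t).

Lemma nactM t (x y : nichols) : nact t (x * y) = nact t x * nact t y.
Proof.
by rewrite -[x]nreprK -[y]nreprK -nprojM !nact_proj tactM nprojM.
Qed.

Lemma nact_one t : nact t 1 = 1 :> nichols.
Proof. by rewrite -[1]/(nproj 1) nact_proj tact_one. Qed.

Lemma nact1 (x : nichols) : nact 1%g x = x.
Proof. by rewrite -[x]nreprK nact_proj tact1. Qed.

Lemma nact_comp s t (x : nichols) : nact (pcomp t s) x = nact t (nact s x).
Proof.
rewrite -[x]nreprK (nact_proj (pcomp t s)) (nact_proj s) (nact_proj t).
by rewrite tact_comp.
Qed.

End Action.

Section Bosonization.
Variables (k : fieldType) (n : nat) (D : rack_datum k n).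
Local Notation B := (nichols D).

(* h : boson stands for the element \sum_t h t # t of B # k S_n. *)
Definition boson : Type := {ffun 'S_n -> B}.
HB.instance Definition _ := GRing.Lmodule.on boson.

Definition bcoef (h : boson) (t : 'S_n) : B := (h : {ffun 'S_n -> B}) t.
Definition bfun (f : 'S_n -> B) : boson := [ffun t => f t].

Lemma bfunE f t : bcoef (bfun f) t = f t. Proof. exact: ffunE. Qed.
Lemma bosonP (f h : boson) : (forall t, bcoef f t = bcoef h t) -> f = h.
Proof. by move=> fh; apply/ffunP. Qed.
Lemma bcoefD (f h : boson) t : bcoef (f + h) t = bcoef f t + bcoef h t.
Proof. exact: ffunE. Qed.
Lemma bcoefZ c (f : boson) t : bcoef (c *: f) t = c *: bcoef f t.
Proof. exact: ffunE. Qed.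
Lemma bcoef0 t : bcoef 0 t = 0. Proof. exact: ffunE. Qed.

Definition smash (b : B) (t : 'S_n) : boson := bfun (fun s => if s == t then b else 0).

(* (a # s) (b # t) = a (s . b) # s t, with s t = u iff t = s^-1 u *)
Definition bmul (f h : boson) : boson :=
  bfun (fun u => \sum_(s : 'S_n) bcoef f s * nact s (bcoef h (pcomp s^-1%g u))).

Lemma bmulA : associative bmul.
Proof.
move=> f g h; apply: bosonP => u; rewrite !bfunE.
pose F s r := bcoef f s * nact s (bcoef g r) *
  nact (pcomp s r) (bcoef h (pcomp (pcomp s r)^-1%g u)).
transitivity (\sum_s \sum_r F s r).
  apply: eq_bigr => s _; rewrite bfunE linear_sum /= mulr_sumr.
  apply: eq_bigr => r _ /=; rewrite nactM -nact_comp mulrA /F /pcomp.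
  by rewrite invMg mulgA.
transitivity (\sum_t \sum_s F s (pcomp s^-1%g t)); last first.
  apply: eq_bigr => t _; rewrite bfunE mulr_suml; apply: eq_bigr => s _.
  by rewrite /F /pcomp mulgKV.
rewrite [RHS]exchange_big /=; apply: eq_bigr => s _.
rewrite [LHS](reindex_inj (h := pcomp s^-1%g)) //=; exact: mulIg.
Qed.

Lemma smashE s t (b : B) : bcoef (smash b s) t = if t == s then b else 0.
Proof. exact: bfunE. Qed.

Lemma bmul_smashl b s (h : boson) u :
  bcoef (bmul (smash b s) h) u = b * nact s (bcoef h (pcomp s^-1%g u)).
Proof.
rewrite bfunE (bigD1 s) //= smashE eqxx big1 ?addr0 // => t /negPf ts.
by rewrite smashE ts mul0r.
Qed.

Lemma bmul1x : left_id (smash 1 1%g) bmul.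
Proof.
move=> h; apply: bosonP => u; rewrite bmul_smashl nact1 mul1r /pcomp.
by rewrite invg1 mulg1.
Qed.

Lemma bmulx1 : right_id (smash 1 1%g) bmul.
Proof.
move=> h; apply: bosonP => u; rewrite bfunE (bigD1 u) //=.
rewrite smashE /pcomp mulgV eqxx nact_one mulr1 big1 ?addr0 // => t tu.
rewrite smashE ifN ?linear0 ?mulr0 //.
by apply: contra tu; rewrite -eq_mulgV1 eq_sym.
Qed.

Lemma bmulDl : left_distributive bmul +%R.
Proof.
move=> f g h; apply: bosonP => u; rewrite bcoefD !bfunE -big_split /=.
by apply: eq_bigr => s _; rewrite bcoefD mulrDl.
Qed.

Lemma bmulDr : right_distributive bmul +%R.
Proof.
move=> f g h; apply: bosonP => u; rewrite bcoefD !bfunE -big_split /=.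
by apply: eq_bigr => s _; rewrite bcoefD -mulrDr -linearD.
Qed.

Lemma bone_neq0 : smash 1 1%g != 0.
Proof.
apply/eqP => /(congr1 (bcoef^~ 1%g)) /eqP.
by rewrite smashE eqxx bcoef0 oner_eq0.
Qed.

HB.instance Definition _ := GRing.Zmodule_isNzRing.Build boson
  bmulA bmul1x bmulx1 bmulDl bmulDr bone_neq0.

Lemma bcoefM (f h : boson) u :
  bcoef (f * h) u = \sum_(s : 'S_n) bcoef f s * nact s (bcoef h (pcomp s^-1%g u)).
Proof. exact: bfunE. Qed.

Lemma bscalerAl c (f g : boson) : c *: (f * g) = (c *: f) * g.
Proof.
apply: bosonP => u; rewrite bcoefZ !bcoefM scaler_sumr.
by apply: eq_bigr => s _; rewrite bcoefZ scalerAl.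
Qed.
HB.instance Definition _ := GRing.Lmodule_isLalgebra.Build k boson bscalerAl.

Lemma bscalerAr c (f g : boson) : c *: (f * g) = f * (c *: g).
Proof.
apply: bosonP => u; rewrite bcoefZ !bcoefM scaler_sumr.
by apply: eq_bigr => s _; rewrite bcoefZ linearZ /= scalerAr.
Qed.
HB.instance Definition _ := GRing.Lalgebra_isAlgebra.Build k boson bscalerAr.

Lemma smashM a s b t : smash a s * smash b t = smash (a * nact s b) (pcomp s t).
Proof.
apply: bosonP => u; rewrite [LHS]bmul_smashl !smashE /pcomp.
rewrite -(inj_eq (mulIg s)) mulgKV; case: eqP => // _.
by rewrite linear0 mulr0.
Qed.

(* Delta(a # t) = a^(1) # (a^(2))_(-1) t (x) (a^(2))_(0) # t *)
Definition bcopr (h : boson) : tensor boson boson :=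
  \sum_(t : 'S_n)
    tlift (fun a b : B => \sum_(g : 'S_n)
      tprod (smash a (pcomp g t)) (smash (ncoact g b) t)) (ncopr (bcoef h t)).

Definition bgen (i : rd_idx D) : boson := smash (nproj (tgen i)) 1%g.

Definition nhomog (m : nat) : set B := [set nproj a | a in [set a | thomog m a = a]].
Definition bhomog (m : nat) : set boson := [set h | forall t, nhomog m (bcoef h t)].

End Bosonization.

Section Comultiplication.
Variables (k : fieldType) (n : nat) (D : rack_datum k n).
Local Notation B := (nichols D).
Local Notation H := (boson D).

Lemma ncoact_linear g : linear (@ncoact k n D g).
Proof.
move=> c x y; rewrite -[x]nreprK -[y]nreprK.
move: (nrepr x) (nrepr y) => u v.
rewrite -(nproj_linear (D:=D) c u v) (ncoact_proj g (c *: u + v)) (ncoact_proj g u)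
  (ncoact_proj g v) /tcoact.
by rewrite (tcomp_linear _ c u v) nproj_linear.
Qed.
HB.instance Definition _ g := GRing.isLinear.Build k B B _ (@ncoact k n D g)
  (@ncoact_linear g).

Lemma ncopr_linear : linear (@ncopr k n D).
Proof.
move=> c x y; rewrite -[x]nreprK -[y]nreprK.
move: (nrepr x) (nrepr y) => u v.
rewrite -(nproj_linear (D:=D) c u v) (ncopr_proj (c *: u + v)) (ncopr_proj u)
  (ncopr_proj v) (tcopr_linear c u v) tlift_linear // => [w|w] d x' y'.
  by rewrite nproj_linear tprod_linl.
by rewrite nproj_linear tprod_linr.
Qed.
HB.instance Definition _ := GRing.isLinear.Build k B (tensor B B) _ (@ncopr k n D)
  ncopr_linear.

Lemma smash_linear t : linear ((@smash k n D)^~ t).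
Proof.
move=> c a b; apply: bosonP => s; rewrite bcoefD bcoefZ !smashE.
by case: eqP => // _; rewrite scaler0 addr0.
Qed.

Let copr_smash (t : 'S_n) (a b : B) : tensor H H :=
  \sum_(g : 'S_n) tprod (smash a (pcomp g t)) (smash (ncoact g b) t).

Let copr_smash_linl t b : linear ((copr_smash t)^~ b).
Proof.
move=> c a a'; rewrite /copr_smash scaler_sumr -big_split /=; apply: eq_bigr => g _.
by rewrite smash_linear tprod_linl.
Qed.

Let copr_smash_linr t a : linear (copr_smash t a).
Proof.
move=> c b b'; rewrite /copr_smash scaler_sumr -big_split /=; apply: eq_bigr => g _.
by rewrite linearP smash_linear tprod_linr.
Qed.

Let lift_lin t := tlift_linear (copr_smash_linl t) (copr_smash_linr t).

Lemma bcopr_linear : linear (@bcopr k n D).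
Proof.
move=> c f h; rewrite /bcopr scaler_sumr -big_split /=; apply: eq_bigr => t _.
by rewrite bcoefD bcoefZ linearP -(lift_lin t).
Qed.

Lemma bcopr_smash b t :
  bcopr (smash b t) = tlift (fun a a' : B => \sum_(g : 'S_n)
      tprod (smash a (pcomp g t)) (smash (ncoact g a') t)) (ncopr b).
Proof.
rewrite /bcopr (bigD1 t) //= smashE eqxx big1 ?addr0 // => s /negPf st.
by rewrite smashE st linear0 (lin0 (lift_lin s)).
Qed.

Lemma ncoact_bas g w :
  ncoact g (nproj (fbas w)) = if wdeg w == g then nproj (fbas w) else 0 :> B.
Proof.
rewrite ncoact_proj /tcoact /tcomp lext_bas.
by case: ifP => // _; rewrite linear0.
Qed.

Lemma copr_smash_bas t a w :
  copr_smash t a (nproj (fbas w)) =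
    tprod (smash a (pcomp (wdeg w) t)) (smash (nproj (fbas w)) t).
Proof.
rewrite /copr_smash (bigD1 (wdeg w)) //= ncoact_bas eqxx big1 ?addr0 // => g.
rewrite eq_sym => /negPf gw; rewrite ncoact_bas gw.
by rewrite (lin0 (smash_linear t)) (lin0 (tprod_linr _)).
Qed.

Lemma bcopr_grp t : bcopr (smash 1 t) = tprod (smash 1 t) (smash 1 t) :> tensor H H.
Proof.
have e1 : 1 = nproj (fbas (FMonom [::])) :> B by rewrite -fmoneE fbas1.
rewrite bcopr_smash {1}e1 ncopr_proj /tcopr lext_bas /=.
rewrite (tlift_tprod (f := fun u v => tprod (nproj u) (nproj v))).
- rewrite (tlift_tprod (copr_smash_linl t) (copr_smash_linr t)).
  have -> : nproj 1 = nproj (fbas (FMonom [::])) :> B by rewrite -e1.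
  by rewrite copr_smash_bas /= -e1 /pcomp mulg1.
- by move=> w c u v; rewrite nproj_linear tprod_linl.
by move=> w c u v; rewrite nproj_linear tprod_linr.
Qed.

Lemma bcopr_gen i :
  bcopr (bgen i) = tprod (bgen i) 1 + tprod (smash 1 (val i)) (bgen i) :> tensor H H.
Proof.
have e1 : 1 = nproj (fbas (FMonom [::])) :> B by rewrite -fmoneE fbas1.
rewrite /bgen bcopr_smash ncopr_proj /tcopr /tgen lext_bas fmU /=.
rewrite tlift_tprod; first last.
- move=> u c v w; rewrite mulrDr -scalerAr !tprod_linr scalerDr addrACA //.
- move=> w c u v; rewrite mulrDr -scalerAr tact_linear !tprod_linl scalerDr addrACA //.
rewrite mulr1 tact_one.
set f := (fun u v => tprod (nproj u) (nproj v)).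
have fl w : linear (f^~ w) by move=> c u v; rewrite /f nproj_linear tprod_linl.
have fr w : linear (f w) by move=> c u v; rewrite /f nproj_linear tprod_linr.
have lD := tlift_linear fl fr 1; rewrite -[X in X + _]scale1r lD !scale1r {lD}.
rewrite !(tlift_tprod fl fr) /f.
have lD := lift_lin 1%g 1; rewrite -[X in X + _]scale1r lD !scale1r {lD}.
rewrite !(tlift_tprod (copr_smash_linl 1%g) (copr_smash_linr 1%g)).
rewrite -[nproj 1]/(1 : B) {1}e1 !copr_smash_bas fmU /= -e1.
by rewrite /pcomp !mul1g.
Qed.

End Comultiplication.

Section Subalgebras.
Variables (k : fieldType) (A : algType k).

Definition is_subspace (S : set A) : Prop :=
  S 0 /\ forall c x y, S x -> S y -> S (c *: x + y).
Definition is_subalgebra (S : set A) : Prop :=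
  [/\ is_subspace S, S 1 & forall x y, S x -> S y -> S (x * y)].
Definition gen_subalgebra (G : set A) : set A :=
  [set x | forall S, is_subalgebra S -> (G `<=` S)%classic -> S x].

End Subalgebras.

Section CoidealSubalgebras.
Variables (k : fieldType) (n : nat) (D : rack_datum k n).
Local Notation H := (boson D).

Definition left_coideal_subalgebra (K : set H) : Prop :=
  is_subalgebra K /\
  forall x, K x -> span [set z | exists h y, K y /\ z = tprod h y] (bcopr x).

Record homogeneous_lcs (K : set H) (Km : nat -> set H) : Prop := HomogeneousLcs {
  hl_lcs : left_coideal_subalgebra K;
  hl_subspace : forall m, is_subspace (Km m);
  (* the sum is direct by hl_deg *)
  hl_sum : K = span [set x | exists m, Km m x];
  hl_one : Km 0%N 1;
  hl_mul : forall i j x y, Km i x -> Km j y -> Km (i + j)%N (x * y);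
  hl_deg : forall m, (Km m `<=` bhomog m)%classic;
  hl_copr : forall m x, Km m x ->
    span [set z | exists i h y,
            [/\ (i <= m)%N, bhomog i h, Km (m - i)%N y & z = tprod h y]] (bcopr x)
}.

Definition KY (Y : {set 'S_n}) : set H :=
  gen_subalgebra [set x | exists2 i : rd_idx D, val i \in Y & x = bgen i].

End CoidealSubalgebras.
Arguments KY {k n} D Y.

Section RackData.
Variables (k : fieldType) (n : nat).

(* The j-cycles for j >= 2 *)
Definition cycles (j : nat) : {set 'S_n} :=
  [set s : 'S_n | [exists x, (#|porbit s x| == j) && perm_on (porbit s x) s]]%SET.

Lemma porbit_conj (s t : 'S_n) x : porbit (s ^ t)%g (t x) = [set t y | y in porbit s x]%SET.
Proof.
apply/setP => y; apply/porbitP/imsetP => [[i ->]|[z /porbitP[i ->] ->]].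
  exists ((s ^+ i)%g x); first exact: mem_porbit.
  by rewrite -conjXg conjgE !permM permK.
by exists i; rewrite -conjXg conjgE !permM permK.
Qed.

Lemma cycles_conj j s t : s \in cycles j -> (s ^ t)%g \in cycles j.
Proof.
rewrite !inE => /existsP[x /andP[/eqP cx /fintype.subsetP px]].
apply/existsP; exists (t x); rewrite porbit_conj card_imset ?cx ?eqxx /=; last exact: perm_inj.
apply/fintype.subsetP => y; rewrite inE -[y](permKV t) => h.
apply/imset_f/px; rewrite inE; apply: contra h => /eqP h.
by rewrite conjgE !permM permK h.
Qed.

Lemma cycles2P s : s \in cycles 2 -> exists a b : 'I_n, (a < b)%N /\ s = tperm a b.
Proof.
rewrite inE => /existsP[x /andP[/eqP cx /fintype.subsetP px]].
have sx : s x != x.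
  apply: contra_eqN cx => /eqP sx; suff -> : porbit s x = [set x]%SET by rewrite cards1.
  apply/setP => y; rewrite inE; apply/porbitP/eqP => [[i ->]|->]; last first.
    by exists 0%N; rewrite expg0 perm1.
  by elim: i => [|i IH]; rewrite ?expg0 ?perm1 // expgSr permM IH.
have orb : porbit s x = [set x; s x]%SET.
  apply/eqP; rewrite eq_sym eqEcard cx cards2 eq_sym sx andbT.
  apply/fintype.subsetP => y; rewrite !inE => /orP[]/eqP ->; first exact: porbit_id.
  by have := mem_porbit s 1 x; rewrite expg1.
have ssx : s (s x) = x.
  have : s (s x) \in porbit s x by have := mem_porbit s 2 x; rewrite expgS expg1 permM.
  by rewrite orb !inE (inj_eq perm_inj) (negPf sx) orbF => /eqP.
have es : s = tperm x (s x).
  apply/permP => y; case: tpermP => [->|->|/eqP yx /eqP ysx] //.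
  apply/eqP/negPn/negP => h; have : y \in porbit s x by apply: px; rewrite inE.
  by rewrite orb !inE (negPf yx) (negPf ysx).
move: sx; rewrite neq_ltn => /orP[] h.
  by exists (s x), x; split=> //; rewrite tpermC.
by exists x, (s x).
Qed.

Definition sgn_chi (i t : 'S_n) : k := (-1) ^+ odd_perm t.

(* chi_(a b)(t) for a < b: the sign of t(b) - t(a) *)
Definition ord_chi (i t : 'S_n) : k :=
  if [exists a : 'I_n, exists b : 'I_n,
        [&& (a < b)%N, i == tperm a b & (t b < t a)%N]] then -1 else 1.

Lemma sgn_chi1 (i : 'S_n) : sgn_chi i 1%g = 1.
Proof. by rewrite /sgn_chi odd_perm1. Qed.
Lemma sgn_chiM (i s t : 'S_n) :
  sgn_chi i (pcomp t s) = sgn_chi (i ^ s)%g t * sgn_chi i s.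
Proof. by rewrite /sgn_chi odd_permM signr_addb mulrC. Qed.

Definition sgn_datum (j : nat) : rack_datum k n :=
  @RackDatum k n (cycles j) sgn_chi (@cycles_conj j)
    (fun i _ => sgn_chi1 i) (fun i s t _ => sgn_chiM i s t).

Lemma ord_chiE (a b : 'I_n) t : (a < b)%N ->
  ord_chi (tperm a b) t = if (t b < t a)%N then -1 else 1.
Proof.
move=> ab; rewrite /ord_chi; congr (if _ then _ else _).
apply/existsP/idP => [[a' /existsP[b' /and3P[ab' /eqP e h]]]|h]; last first.
  by exists a; apply/existsP; exists b; rewrite ab eqxx.
have [ea eb] : a' = a /\ b' = b.
  have ea : tperm a b a' = b' by rewrite e tpermL.
  move: ea ab'; case: tpermP => [-> <- //|-> <-|_ _ ->]; last by rewrite ltnn.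
  by rewrite ltnNge ltnW.
by rewrite ea eb in h.
Qed.

Lemma ord_chi1 i : i \in cycles 2 -> ord_chi i 1%g = 1.
Proof.
by move=> /cycles2P[a [b [ab ->]]]; rewrite ord_chiE // !perm1 ltnNge ltnW.
Qed.

Lemma ord_chiM i s t : i \in cycles 2 ->
  ord_chi i (pcomp t s) = ord_chi (i ^ s)%g t * ord_chi i s.
Proof.
move=> /cycles2P[a [b [ab ->]]]; rewrite ord_chiE // [X in _ * X]ord_chiE //.
rewrite /pcomp !permM tpermJ.
have sab : s a != s b by rewrite (inj_eq perm_inj) neq_ltn ab.
case: (ltngtP (s b) (s a)) => [ba|ba|/val_inj e]; last by rewrite e eqxx in sab.
  rewrite tpermC ord_chiE // mulrN1.
  have : t (s a) != t (s b) by rewrite (inj_eq perm_inj).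
  by rewrite neq_ltn; case: ltngtP => //; rewrite opprK.
by rewrite ord_chiE // mulr1.
Qed.

Definition ord_datum : rack_datum k n :=
  @RackDatum k n (cycles 2) ord_chi (@cycles_conj 2) ord_chi1 ord_chiM.

End RackData.

(* (O_2^3, -1), (O_2^4, -1), (O_2^4, chi), (O_4^4, -1) *)
Inductive fd_datum (k : fieldType) : forall n, rack_datum k n -> Prop :=
| FdO23 : fd_datum (sgn_datum k 3 2)
| FdO24 : fd_datum (sgn_datum k 4 2)
| FdO24chi : fd_datum (ord_datum k 4)
| FdO44 : fd_datum (sgn_datum k 4 4).

(* Main.v *)
Require Import Defs.
From mathcomp Require Import all_boot all_order all_algebra all_fingroup.
From mathcomp Require Import finmap monalg.
From mathcomp Require Import boolp classical_sets.
Set Implicit Arguments.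
Unset Strict Implicit.
Unset Printing Implicit Defensive.
Import GRing.Theory.
Local Open Scope ring_scope.

(** Write [Delta_(m-1,1) b = \sum_l d_l b (x) x_l] for the component of the braided
    comultiplication of the Nichols algebra [B]. If [K] is a homogeneous left coideal subalgebra
    inside [B # 1] and [Y] is the set of [i] with [x_i] in [K(1)], then [K(1)] is spanned by these
    [x_i], and, the last tensor factor of an iterated coproduct of an element of [K] being in
    [K(1)], every skew derivation [d_l] with [l] outside [Y] kills [K]. So it suffices that an
    element of [B] killed by all [d_l], [l] outside [Y], lies in the subalgebra [K_Y].
    This is proved by descending induction on [Y]: for a suitable [z] outside [Y], [K_(Y + z)] is
    the sum of the left modules [K_Y w_r] for finitely many words [w_r], the operators [d_l] are
    left [K_Y]-linear, and composites of them, along words in the complement of [Y], form a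
    triangular system with respect to the [w_r] other than the empty word, so that all their
    coefficients vanish. Up to conjugation by the rack there are few [Y]; the words, and the
    straightening relations, which follow from the quadratic relations of [B], are certificates
    verified by computation. *)

(** * Skew derivations of the tensor algebra *)

Lemma linZ (k : fieldType) (V W : lmodType k) (f : V -> W) c v :
  linear f -> f (c *: v) = c *: f v.
Proof. by move=> lf; rewrite -[c *: v]addr0 lf (lin0 lf) addr0. Qed.

Lemma linD (k : fieldType) (V W : lmodType k) (f : V -> W) u v :
  linear f -> f (u + v) = f u + f v.
Proof. by move=> lf; rewrite -[u in LHS]scale1r lf scale1r. Qed.

Lemma lin_comp (k : fieldType) (U V W : lmodType k) (f : U -> V) (g : V -> W) :
  linear f -> linear g -> linear (fun u => g (f u)).
Proof. by move=> lf lg c u v; rewrite lf lg. Qed.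

Lemma lin_add (k : fieldType) (V W : lmodType k) (f g : V -> W) :
  linear f -> linear g -> linear (fun v => f v + g v).
Proof. by move=> lf lg c u v; rewrite lf lg scalerDr addrACA. Qed.

Lemma lin_sum (k : fieldType) (V W : lmodType k) (I : Type) (s : seq I) (f : I -> V -> W) :
  (forall i, linear (f i)) -> linear (fun v => \sum_(i <- s) f i v).
Proof.
move=> lf c u v; rewrite scaler_sumr -big_split; apply: eq_bigr => i _; exact: lf.
Qed.

Lemma lin_scale (k : fieldType) (V W : lmodType k) (f : V -> W) c :
  linear f -> linear (fun v => c *: f v).
Proof. by move=> lf d u v; rewrite lf scalerDr !scalerA mulrC. Qed.

(** * Contraction of one tensor factor by a linear form *)

Section TensorMaps.
Variables (k : fieldType) (U W : lmodType k).

Lemma tensor_linear_ext (Z : lmodType k) (f g : tensor U W -> Z) :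
  linear f -> linear g -> (forall u w, f (tprod u w) = g (tprod u w)) -> f =1 g.
Proof.
move=> lf lg fg x; rewrite -[x]lreprK; move: (lrepr x).
apply: fmod_linear_ext => [c u v|c u v|[u w]]; last exact: fg.
  by rewrite lproj_linear lf.
by rewrite lproj_linear lg.
Qed.

Definition contr (phi : W -> k) (z : tensor U W) : U := tlift (fun u w => phi w *: u) z.

Section Contr.
Variable phi : W -> k^o.
Hypothesis lphi : linear phi.

Let contr_linl w : linear (fun u : U => phi w *: u).
Proof. by move=> c u v; rewrite scalerDr !scalerA mulrC. Qed.

Let contr_linr (u : U) : linear (fun w : W => phi w *: u).
Proof.
move=> c v w; transitivity ((c * phi v + phi w) *: u); first by rewrite lphi.
by rewrite scalerDl scalerA.
Qed.

Lemma contr_linear : linear (contr phi : tensor U W -> U).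
Proof. exact: tlift_linear contr_linl contr_linr. Qed.

Lemma contr_tprod u w : contr phi (tprod u w) = phi w *: u.
Proof. exact: (tlift_tprod contr_linl contr_linr). Qed.

End Contr.

Definition lcontr (phi : U -> k) (z : tensor U W) : W := tlift (fun u w => phi u *: w) z.

Section LeftContr.
Variable phi : U -> k^o.
Hypothesis lphi : linear phi.

Let lcontr_linl (w : W) : linear (fun u : U => phi u *: w).
Proof.
move=> c u v; transitivity ((c * phi u + phi v) *: w); first by rewrite lphi.
by rewrite scalerDl scalerA.
Qed.

Let lcontr_linr (u : U) : linear (fun w : W => phi u *: w).
Proof. by move=> c v w; rewrite scalerDr !scalerA mulrC. Qed.

Lemma lcontr_linear : linear (lcontr phi : tensor U W -> W).
Proof. exact: tlift_linear lcontr_linl lcontr_linr. Qed.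

Lemma lcontr_tprod u w : lcontr phi (tprod u w) = phi u *: w.
Proof. exact: (tlift_tprod lcontr_linl lcontr_linr). Qed.

End LeftContr.

End TensorMaps.

(** * Words, counits and the twisted Leibniz rule in the tensor algebra *)

Section FreeWords.
Variables (k : fieldType) (n : nat) (D : rack_datum k n).
Local Notation I := (rd_idx D).
Local Notation T := (fmod k {fmonom I}).
Local Notation word w := (fbas (FMonom w) : T).

Lemma fcoef_linear (J : choiceType) (j : J) : linear (fcoef j : fmod k J -> k^o).
Proof. by move=> c a b; rewrite fcoefD fcoefZ. Qed.

Lemma word0 : word [::] = 1.
Proof. by rewrite -fmoneE fbas1. Qed.

Lemma word_cat u v : word (u ++ v) = word u * word v.
Proof. by rewrite fbasM fmM_cat. Qed.

Lemma word_cons i w : word (i :: w) = tgen i * word w.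
Proof. by rewrite -cat1s word_cat /tgen fmuE. Qed.

Lemma free_ext (V : lmodType k) (f g : T -> V) : linear f -> linear g ->
  (forall w, f (word w) = g (word w)) -> f =1 g.
Proof. by move=> lf lg fg; apply: fmod_linear_ext => // -[w]. Qed.

Lemma tcomp_word P w : tcomp P (fbas w) = if P w then fbas w else 0 :> T.
Proof. by rewrite /tcomp lext_bas. Qed.

Lemma fmod_span (J : choiceType) (a : fmod k J) : Defs.span [set b | exists j, b = fbas j] a.
Proof.
have {1}-> : a = lext (fun j => fbas j) a.
  move: a; apply: fmod_linear_ext => [//||j]; first exact: lext_linear.
  by rewrite lext_bas.
rewrite /lext; elim: (fsupp a) => [|j s IH]; first by rewrite big_nil; left.
by rewrite big_cons; right=> //; exists j.
Qed.

Lemma word_span (a : T) : Defs.span [set b | exists w, b = word w] a.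
Proof.
have := fmod_span a; apply: (span_map (f := id)) => // _ [[w] ->].
by apply: span_incl; exists w.
Qed.

Lemma tensor_span (U W : lmodType k) (z : tensor U W) :
  Defs.span [set y | exists u w, y = tprod u w] z.
Proof.
rewrite -[z]lreprK; have := fmod_span (lrepr z).
apply: (span_map (@lproj_linear _ _ _)) => _ [[u w] ->].
by apply: span_incl; exists u, w.
Qed.

(** The equation [tcomp P r = r] says that only words satisfying [P] occur in [r]. Arguments on
    homogeneous elements go through this lemma instead of an explicit expansion in words. *)
Lemma tcomp_ext (V : lmodType k) P (r : T) (f g : T -> V) : linear f -> linear g ->
  tcomp P r = r -> (forall w, P (FMonom w) -> f (word w) = g (word w)) -> f r = g r.
Proof.
move=> lf lg <- fg; move: r; apply: free_ext => [||w].
- exact: lin_comp (@tcomp_linear _ _ _ _) lf.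
- exact: lin_comp (@tcomp_linear _ _ _ _) lg.
by rewrite tcomp_word; case: ifP => [/fg|_] //; rewrite (lin0 lf) (lin0 lg).
Qed.

Lemma mulr_linear (A : algType k) (a : A) : linear ( *%R a).
Proof. by move=> c x y; rewrite mulrDr scalerAr. Qed.

Lemma mull_linear (A : algType k) (a : A) : linear ( *%R^~ a).
Proof. by move=> c x y; rewrite mulrDl scalerAl. Qed.

Lemma tgen_act t (i : I) : tact t (tgen i : T) = rd_chi D (val i) t *: tgen (iact t i).
Proof. by rewrite /tgen tact_bas /wact !fmuE /= big_seq1. Qed.

Lemma iact_inj t : injective (@iact _ _ D t).
Proof. by move=> i j /(congr1 val) /conjg_inj /val_inj. Qed.

Lemma tact_iact t (i : I) (a : T) : tact (val (iact t i)) (tact t a) = tact t (tact (val i) a).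
Proof. by rewrite -!tact_comp /Defs.pcomp /= -conjgC. Qed.

Lemma wdeg_cat (u v : seq I) : wdeg (u ++ v) = Defs.pcomp (wdeg u) (wdeg v).
Proof. by elim: u => [|i u IH] /=; rewrite /Defs.pcomp ?mulg1 // IH /Defs.pcomp mulgA. Qed.

Lemma wdeg_act t (w : seq I) : wdeg (map (iact t) w) = (wdeg w ^ t)%g.
Proof. by elim: w => [|i w IH] /=; rewrite ?conj1g // IH /Defs.pcomp conjMg. Qed.

Section LeftMult.
Variable i : I.

(* Multiplication by Delta(x_i) in the braided tensor square *)
Definition lmul_copr : tensor T T -> tensor T T :=
  tlift (fun u v : T => tprod (tgen i * u) v + tprod (tact (val i) u) (tgen i * v)).

Let fl v : linear (fun u : T => tprod (tgen i * u) v + tprod (tact (val i) u) (tgen i * v)).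
Proof.
move=> c x y; rewrite mulr_linear tact_linear !tprod_linl scalerDr.
by rewrite !addrA; congr (_ + _); rewrite addrAC.
Qed.

Let fr u : linear (fun v : T => tprod (tgen i * u) v + tprod (tact (val i) u) (tgen i * v)).
Proof.
move=> c x y; rewrite mulr_linear !tprod_linr scalerDr.
by rewrite !addrA; congr (_ + _); rewrite addrAC.
Qed.

Lemma lmul_copr_linear : linear lmul_copr.
Proof. exact: tlift_linear fl fr. Qed.

Lemma lmul_copr_tprod u v : lmul_copr (tprod u v) =
  tprod (tgen i * u) v + tprod (tact (val i) u) (tgen i * v).
Proof. exact: (tlift_tprod fl fr). Qed.

Lemma tcopr_genM a : tcopr (tgen i * a) = lmul_copr (tcopr a).
Proof.
move: a; apply: free_ext => [||w].
- exact: lin_comp (mulr_linear _) (@tcopr_linear _ _ _).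
- exact: lin_comp (@tcopr_linear _ _ _) lmul_copr_linear.
by rewrite -word_cons /tcopr !lext_bas.
Qed.

End LeftMult.

Lemma tcopr1 : tcopr 1 = tprod (1 : T) (1 : T).
Proof. by rewrite -word0 /tcopr lext_bas /= word0. Qed.

Lemma fcoef1 (w : {fmonom I}) : fcoef w (1 : T) = (size w == 0%N)%:R.
Proof.
rewrite -word0 fcoef_bas; congr ((nat_of_bool _)%:R).
by rewrite size_eq0 eq_sym fmP.
Qed.

Lemma fcoef_gen_mul0 i (v : T) : fcoef mone (tgen i * v) = 0.
Proof.
move: v; apply: (@free_ext k^o) => [c x y|c x y|w].
- by rewrite mulr_linear fcoef_linear.
- by rewrite scaler0 addr0.
rewrite -word_cons fcoef_bas; case: eqP => // /(congr1 (@fmonom_val _)).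
by rewrite fm1.
Qed.

Lemma fcoef_gen_mul i l (v : T) :
  fcoef (fmu l) (tgen i * v) = (i == l)%:R * fcoef mone v.
Proof.
move: v; apply: (@free_ext k^o) => [c x y|c x y|w].
- by rewrite mulr_linear fcoef_linear.
- by rewrite (fcoef_linear (J := {fmonom I}) _ c x y) mulrDr mulrCA.
rewrite -word_cons !fcoef_bas -natrM mulnb; congr (_%:R : k); congr nat_of_bool.
apply/eqP/andP => [/(congr1 (@fmonom_val _))|[/eqP -> /eqP w1]].
  by rewrite fmU /= => -[-> w0]; split=> //; rewrite fmP fm1 /= w0.
by apply/eqP; rewrite fmP fmU; move/(congr1 (@fmonom_val _)): w1; rewrite fm1 /= => ->.
Qed.

(** Counit axiom for the second factor, by induction on words: of the two terms of a product with
    Delta(x_i), the one having x_i in the second factor has no constant coefficient there, so the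
    contraction commutes with left multiplication by x_i. *)
Lemma contr_counit (a : T) : contr (fcoef mone) (tcopr a) = a.
Proof.
have lc := contr_linear (U := T) (fcoef_linear (mone : {fmonom I})).
move: a; apply: free_ext => [c x y|//|w]; first by rewrite tcopr_linear lc.
elim: w => [|i w IH].
  rewrite word0 tcopr1 contr_tprod ?fcoef1 ?fm1 ?eqxx ?scale1r //; exact: fcoef_linear.
rewrite word_cons tcopr_genM -{2}IH; move: (tcopr _).
apply: tensor_linear_ext => [c x y|c x y|u v].
- by rewrite lmul_copr_linear lc.
- by rewrite lc mulr_linear.
rewrite lmul_copr_tprod -[X in X + _]scale1r lc scale1r.
rewrite !contr_tprod; try exact: fcoef_linear.
rewrite fcoef_gen_mul0 scale0r addr0.
exact: fscalerAr.
Qed.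

Lemma fcoef_mone_act t (u : T) : fcoef mone (tact t u) = fcoef mone u.
Proof.
move: u; apply: (@free_ext k^o) => [||w].
- exact: lin_comp (@tact_linear _ _ _ t) (fcoef_linear _).
- exact: fcoef_linear.
rewrite tact_bas fcoefZ !fcoef_bas !fmP !fm1 /=.
by case: w => [|i w] /=; rewrite ?big_nil ?mul1r ?mulr0.
Qed.

(** Here the other term survives. It carries the action of [val i] on the first factor, and this
    action preserves constant coefficients. *)
Lemma lcontr_counit (a : T) : lcontr (fcoef mone) (tcopr a) = a.
Proof.
have lc := lcontr_linear (W := T) (fcoef_linear (mone : {fmonom I})).
move: a; apply: free_ext => [|//|w]; first exact: lin_comp (@tcopr_linear _ _ _) lc.
elim: w => [|i w IH].
  rewrite word0 tcopr1 lcontr_tprod ?fcoef1 ?fm1 ?eqxx ?scale1r //; exact: fcoef_linear.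
rewrite word_cons tcopr_genM -{2}IH; move: (tcopr _).
apply: tensor_linear_ext => [||u v].
- exact: lin_comp (@lmul_copr_linear i) lc.
- exact: lin_comp lc (mulr_linear _).
rewrite lmul_copr_tprod (linD _ _ lc) !lcontr_tprod; try exact: fcoef_linear.
rewrite fcoef_gen_mul0 scale0r add0r fcoef_mone_act; exact: fscalerAr.
Qed.

(* Delta_(m-1,1)(a) = \sum_l tskew l a (x) x_l *)
Definition tskew (l : I) (a : T) : T := contr (fcoef (fmu l)) (tcopr a).

Lemma tskew_linear l : linear (tskew l).
Proof.
by move=> c a b; rewrite /tskew tcopr_linear contr_linear //; exact: fcoef_linear.
Qed.

Lemma tskew1 l : tskew l 1 = 0.
Proof.
rewrite /tskew tcopr1 contr_tprod; last exact: fcoef_linear.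
by rewrite fcoef1 fmU scale0r.
Qed.

Lemma tskew_genM l i a :
  tskew l (tgen i * a) = tgen i * tskew l a + (i == l)%:R *: tact (val i) a.
Proof.
(* Writing the last [a] as a contraction of its own coproduct makes both sides linear in [tcopr a],
   so that pure tensors suffice. *)
rewrite /tskew tcopr_genM -{3}[a]contr_counit; move: (tcopr a).
have ll := fcoef_linear (fmu l); have l1 := fcoef_linear (mone : {fmonom I}).
apply: tensor_linear_ext => [c x y|c x y|u v].
- by rewrite lmul_copr_linear (contr_linear ll).
- rewrite (contr_linear ll) (contr_linear l1) tact_linear mulr_linear.
  rewrite !scalerDr !scalerA [c * _]mulrC -!scalerA.
  by rewrite !addrA; congr (_ + _); rewrite addrAC.
rewrite lmul_copr_tprod -[X in X + _]scale1r (contr_linear ll) scale1r.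
rewrite !(contr_tprod ll) (contr_tprod l1) fcoef_gen_mul -!scalerAr.
by rewrite linearZ /= scalerA.
Qed.

(** A last letter x_l in the coproduct of [a * b] comes from [b], or from [a]; in the second case
    the braiding has moved it past [b], on which it acts through its group element. *)
Lemma tskewM l a b : tskew l (a * b) = a * tskew l b + tskew l a * tact (val l) b.
Proof.
move: a; apply: free_ext => [c x y|c x y|w].
- by rewrite mull_linear tskew_linear.
- by rewrite tskew_linear !mulrDl scalerDr !scalerAl !addrA; congr (_ + _); rewrite addrAC.
elim: w => [|i w IH]; first by rewrite word0 tskew1 mul0r addr0 !mul1r.
rewrite word_cons -mulrA !tskew_genM IH mulrDr tactM !mulrDl -!addrA -!mulrA.
congr (_ + (_ + _)); rewrite -scalerAl.
by case: eqP => [->|]; rewrite ?scale0r.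
Qed.

(** The coproduct is equivariant, and [t] sends x_l to a multiple of x_(t.l) by the scalar that
    appears here. *)
Lemma tskew_act l t (a : T) : tskew (iact t l) (tact t a) = rd_chi D (val l) t *: tact t (tskew l a).
Proof.
move: a; apply: free_ext => [c x y|c x y|w].
- by rewrite tact_linear tskew_linear.
- by rewrite tskew_linear tact_linear scalerDr !scalerA mulrC.
elim: w => [|i w IH]; first by rewrite word0 tact_one !tskew1 linear0 scaler0.
rewrite word_cons tactM tgen_act -scalerAl.
rewrite (linZ _ _ (tskew_linear _)) !tskew_genM IH.
rewrite (linD _ _ (tact_linear t)) (linZ _ _ (tact_linear t)) tactM tgen_act !scalerDr.
rewrite (inj_eq (@iact_inj t)) tact_iact -fscalerAl -fscalerAr !scalerA mulrC.
by case: eqP => [->|]; rewrite ?mulr1 // !mulr0 !scale0r.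
Qed.

End FreeWords.

(** * The quadratic relations *)

Section QuadraticRelations.
Variables (k : fieldType) (n : nat) (D : rack_datum k n).
Local Notation I := (rd_idx D).
Local Notation T := (fmod k {fmonom I}).
Local Notation word w := (fbas (FMonom w) : T).

Definition deg2 (g : 'S_n) : pred {fmonom I} := fun w => (size w == 2%N) && (wdeg w == g).

(* [r] is a primitive element of degree 2 and of S_n-degree g for some g. *)
Definition quad_rel (r : T) : Prop :=
  exists2 g, tcomp (deg2 g) r = r & forall l, tskew l r = 0.

Definition quad_gens : set T :=
  [set a | exists u r v, quad_rel r /\ a = word u * r * word v].
Definition quad_ideal : set T := Defs.span quad_gens.

Lemma quad_ideal_mull a b : quad_ideal b -> quad_ideal (a * b).
Proof.
move=> Ib; have := word_span a.
apply: (span_map (mull_linear b)) => _ [w ->].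
apply: (span_map (mulr_linear (word w)) _ Ib) => _ [u [r [v [qr ->]]]].
by apply: span_incl; exists (w ++ u), r, v; rewrite word_cat !mulrA.
Qed.

Lemma quad_ideal_mulr a b : quad_ideal a -> quad_ideal (a * b).
Proof.
move=> Ia; have := word_span b.
apply: (span_map (mulr_linear a)) => _ [w ->].
apply: (span_map (mull_linear (word w)) _ Ia) => _ [u [r [v [qr ->]]]].
by apply: span_incl; exists u, r, (v ++ w); rewrite word_cat !mulrA.
Qed.

Lemma quad_rel_ideal r : quad_rel r -> quad_ideal r.
Proof.
by move=> qr; apply: span_incl; exists [::], r, [::]; rewrite word0 mul1r mulr1.
Qed.

Lemma quad_rel_act t r : quad_rel r -> quad_rel (tact t r).
Proof.
move=> [g rg r0]; exists (g ^ t)%g => [|l].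
  apply: (tcomp_ext (f := fun a => tcomp (deg2 (g ^ t)%g) (tact t a)) (g := tact t) _ _ rg) => [||w].
  - exact: lin_comp (@tact_linear _ _ _ _) (@tcomp_linear _ _ _ _).
  - exact: tact_linear.
  move=> /andP[/= /eqP w2 /eqP wg]; rewrite tact_bas /wact /= linearZ /= tcomp_word.
  by rewrite /deg2 /= size_map w2 wdeg_act wg !eqxx.
have -> : l = iact t (iact t^-1 l) by apply/val_inj; rewrite /= conjgKV.
by rewrite tskew_act r0 linear0 scaler0.
Qed.

Lemma quad_ideal_act t a : quad_ideal a -> quad_ideal (tact t a).
Proof.
apply: (span_map (tact_linear t)) => _ [u [r [v [qr ->]]]].
rewrite !tactM; apply/quad_ideal_mulr/quad_ideal_mull/quad_rel_ideal.
exact: quad_rel_act.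
Qed.

(** As [r] is homogeneous, all words of [u r v] have the same length and the same S_n-degree. Since
    [P] depends on these two only, the projection either keeps the product or kills it. *)
Lemma tcomp_quad_gen P u r v : quad_rel r ->
  (forall w w' : seq I, size w = size w' -> wdeg w = wdeg w' ->
    P (FMonom w) = P (FMonom w')) ->
  exists b : bool, tcomp P (word u * r * word v) = if b then word u * r * word v else 0.
Proof.
move=> [g rg _] Pw.
case: (pselect (exists2 w0, deg2 g (FMonom w0) & P (FMonom (u ++ w0 ++ v)))) => h;
  [exists true|exists false].
  case: h => w0 /andP[/= /eqP w02 /eqP w0g] Pw0.
  apply: (tcomp_ext (f := fun a => tcomp P (word u * a * word v))
    (g := fun a => word u * a * word v) _ _ rg) => [||w].
  - apply: (lin_comp _ (@tcomp_linear _ _ _ _)).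
    exact: lin_comp (mulr_linear (word u)) (mull_linear (word v)).
  - exact: lin_comp (mulr_linear (word u)) (mull_linear (word v)).
  move=> /andP[/= /eqP w2 /eqP wg].
  rewrite -!word_cat tcomp_word ifT // -catA -(Pw (u ++ w0 ++ v)) //.
    by rewrite !size_cat w2 w02.
  by rewrite !wdeg_cat wg w0g.
apply: (tcomp_ext (f := fun a => tcomp P (word u * a * word v))
  (g := fun a => 0) _ _ rg) => [||w].
- apply: (lin_comp _ (@tcomp_linear _ _ _ _)).
  exact: lin_comp (mulr_linear (word u)) (mull_linear (word v)).
- by move=> c x y; rewrite scaler0 addr0.
move=> dw; rewrite -!word_cat tcomp_word -catA; case: ifP => // Puwv.
by case: h; exists w.
Qed.

(** Serves for the S_n-coaction and for the grading by length at once. *)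
Lemma quad_ideal_comp P a :
  (forall w w' : seq I, size w = size w' -> wdeg w = wdeg w' ->
    P (FMonom w) = P (FMonom w')) ->
  quad_ideal a -> quad_ideal (tcomp P a).
Proof.
move=> Pw; apply: (span_map (tcomp_linear P)) => _ [u [r [v [qr ->]]]].
have [[] ->] := tcomp_quad_gen u v qr Pw; last by left.
by apply: span_incl; exists u, r, v.
Qed.

Lemma quad_ideal_ge2 a (w : {fmonom I}) : quad_ideal a -> (size w < 2)%N -> fcoef w a = 0.
Proof.
move=> Ia w2; elim: Ia => [|c _ b [u [r [v [[g rg _] ->]]]] _ IH]; first by rewrite fcoef0.
rewrite fcoefD fcoefZ IH addr0.
rewrite (tcomp_ext (f := fun a => fcoef w (word u * a * word v) : k^o)
  (g := fun a => 0) _ _ rg) ?mulr0 // => [||x].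
- have l1 := lin_comp (mulr_linear (word u)) (mull_linear (word v)).
  exact: lin_comp l1 (fcoef_linear w).
- by move=> d x y; rewrite scaler0 addr0.
move=> /andP[/= /eqP x2 _]; rewrite -!word_cat fcoef_bas; case: eqP => // xw.
by move: w2; rewrite -xw /= !size_cat x2 addn2 addSn.
Qed.

Definition tensor_ideal : set (tensor T T) :=
  Defs.span [set z | exists u v, (quad_ideal u \/ quad_ideal v) /\ z = tprod u v].

Lemma tensor_ideal_lmul i z : tensor_ideal z -> tensor_ideal (lmul_copr i z).
Proof.
apply: (span_map (lmul_copr_linear i)) => _ [u [v [Iuv ->]]].
rewrite lmul_copr_tprod; apply: spanD; apply: span_incl.
  exists (tgen i * u), v; split=> //.
  by case: Iuv => h; [left; apply: quad_ideal_mull|right].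
exists (tact (val i) u), (tgen i * v); split=> //.
by case: Iuv => h; [left; apply: quad_ideal_act|right; apply: quad_ideal_mull].
Qed.

(* Left multiplication by Delta(a) in the braided tensor square *)
Definition lmul_tcopr (z : tensor T T) (a : T) : tensor T T :=
  lext (fun w : {fmonom I} => foldr (@lmul_copr k n D) z w) a.

Lemma tcoprM a b : tcopr (a * b) = lmul_tcopr (tcopr b) a.
Proof.
move: a; apply: free_ext => [||w].
- exact: lin_comp (mull_linear b) (@tcopr_linear _ _ _).
- exact: lext_linear.
rewrite /lmul_tcopr lext_bas; elim: w => [|i w IH]; first by rewrite word0 mul1r.
by rewrite word_cons -mulrA tcopr_genM IH.
Qed.

Lemma lmul_tcopr_linear a : linear (lmul_tcopr^~ a).
Proof.
have ll (w : seq I) : linear (fun z => foldr (@lmul_copr k n D) z w).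
  by elim: w => [|i w IH] c x y //=; rewrite IH lmul_copr_linear.
by apply: lin_sum => w; apply: lin_scale; exact: ll.
Qed.

(** The coproduct of [r] is r (x) 1 + \sum_l d_l r (x) x_l + 1 (x) r. In the braided product with u
    (x) v its second factors pass [u] by acting on it, x_l through l and [r] through its degree [g].
    For a quadratic relation the middle sum vanishes. *)
Lemma lmul_tcopr_quad g r u v : tcomp (deg2 g) r = r ->
  lmul_tcopr (tprod u v) r = tprod (r * u) v
    + \sum_l tprod (tskew l r * tact (val l) u) (tgen l * v) + tprod (tact g u) (r * v).
Proof.
move=> rg.
apply: (tcomp_ext _ _ rg (f := lmul_tcopr (tprod u v)) (g := fun r => tprod (r * u) v
  + \sum_l tprod (tskew l r * tact (val l) u) (tgen l * v) + tprod (tact g u) (r * v))).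
- exact: lext_linear.
- apply: lin_add; last exact: lin_comp (mull_linear v) (tprod_linr (tact g u)).
  apply: lin_add; first exact: lin_comp (mull_linear u) (tprod_linl v).
  apply: lin_sum => l; apply: (lin_comp _ (tprod_linl (tgen l * v))).
  exact: lin_comp (@tskew_linear _ _ _ l) (mull_linear _).
move=> [|i [|j [|? ?]]] // /andP[_ /=]; rewrite {2}/Defs.pcomp mul1g => /eqP <-.
rewrite /lmul_tcopr lext_bas /= lmul_copr_tprod (linD _ _ (lmul_copr_linear i)).
rewrite !lmul_copr_tprod !word_cons word0 mulr1 -!mulrA tactM -tact_comp.
rewrite [X in X = _]addrA; congr (_ + _); rewrite -[X in X = _]addrA; congr (_ + _).
have e l : tskew l (tgen i * tgen j : T) =
    (j == l)%:R *: tgen i + (i == l)%:R *: tact (val i) (tgen j).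
  rewrite tskew_genM -[X in tskew l X]mulr1 tskew_genM tskew1 mulr0 add0r tact_one.
  by rewrite -fscalerAr mulr1.
rewrite addrC (eq_bigr (fun l => (j == l)%:R *: tprod (tgen i * tact (val l) u) (tgen l * v)
  + (i == l)%:R *: tprod (tact (val i) (tgen j) * tact (val l) u) (tgen l * v))).
  have dl (m : I) (F : I -> tensor T T) : \sum_l (m == l)%:R *: F l = F m.
    rewrite (bigD1 m) //= eqxx scale1r big1 ?addr0 // => l.
    by rewrite eq_sym => /negPf ->; rewrite scale0r.
  by rewrite big_split /= !dl.
move=> l _; rewrite e mulrDl -!fscalerAl tprod_linl.
by rewrite (linZ _ _ (tprod_linl _)).
Qed.

(** Induction on the left word reduces to [r * word v]. On a pure tensor x (x) y of the coproduct of
    [v], the primitive [r] contributes only r x (x) y and (g . x) (x) r y. *)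
Lemma quad_ideal_copr a : quad_ideal a -> tensor_ideal (tcopr a).
Proof.
apply: (span_map (@tcopr_linear _ _ _)) => _ [u [r [v [qr ->]]]].
rewrite -mulrA; have [g rg r0] := qr.
elim: u => [|i u IH]; last by rewrite word_cons -mulrA tcopr_genM; apply: tensor_ideal_lmul.
rewrite word0 mul1r tcoprM; have := tensor_span (tcopr (word v)).
apply: (span_map (lmul_tcopr_linear r)) => _ [x [y ->]].
rewrite (lmul_tcopr_quad _ _ rg) big1 ?addr0; last first.
  by move=> l _; rewrite r0 mul0r (lin0 (tprod_linl _)).
have Ir := quad_rel_ideal qr.
apply: spanD; apply: span_incl.
  by exists (r * x), y; split=> //; left; apply: quad_ideal_mulr.
by exists (tact g x), (r * y); split=> //; right; apply: quad_ideal_mulr.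
Qed.

(** The ideal generated by the quadratic relations is one of the candidates whose sum defines the
    Nichols algebra. Quadratic relations of [B] can therefore be certified by skew derivations
    alone. *)
Lemma quad_rel_nproj r : quad_rel r -> nproj r = 0.
Proof.
move=> qr; apply: nproj0; suff cI : nichols_cand quad_ideal.
  by apply: nichols_ideal_max cI _ _; apply: quad_rel_ideal.
split.
- exact: span_lin.
- exact: quad_ideal_mull.
- exact: quad_ideal_mulr.
- exact: quad_ideal_act.
- by move=> g a; apply: quad_ideal_comp => w w' _ /= ->.
- by move=> m a; apply: quad_ideal_comp => w w' /= ->.
- exact: quad_ideal_ge2.
- exact: quad_ideal_copr.
Qed.

End QuadraticRelations.

(** * Skew derivations of the Nichols algebra *)

Section NicholsSkew.
Variables (k : fieldType) (n : nat) (D : rack_datum k n).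
Local Notation I := (rd_idx D).
Local Notation T := (fmod k {fmonom I}).
Local Notation B := (nichols D).

(** The ideal is a coideal, and its elements have no terms of degree below 2. So reading the
    coefficient of x_l in the second factor leaves only terms whose first factor lies in the
    ideal. *)
Lemma tskew_nichols l (a : T) : nichols_ideal a -> nichols_ideal (tskew l a).
Proof.
move=> Ia; have := nc_copr (nichols_ideal_cand D) Ia.
have lf := fcoef_linear (k := k) (fmu l).
apply: (span_map (contr_linear lf)) => _ [u [v [Iuv ->]]]; rewrite contr_tprod //.
case: Iuv => Iu; first exact: spanZ.
have -> : fcoef (fmu l) v = 0; last by rewrite scale0r; left.
by apply: (nc_ge2 (nichols_ideal_cand D) Iu); rewrite fmU.
Qed.

Definition nskew l (b : B) : B := nproj (tskew l (nrepr b)).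

Lemma nskew_proj l (a : T) : nskew l (nproj a) = nproj (tskew l a).
Proof.
apply/nproj_eq; have : nichols_ideal (nrepr (nproj a) - a) by exact: lrepr_proj.
move=> /(tskew_nichols l); rewrite -scaleN1r addrC (tskew_linear l) scaleN1r.
by rewrite addrC.
Qed.

Lemma nskew_linear l : linear (nskew l).
Proof.
move=> c x y; rewrite -[x]nreprK -[y]nreprK -(nproj_linear (D := D)) !nskew_proj.
by rewrite tskew_linear nproj_linear.
Qed.

Lemma nskew1 l : nskew l 1 = 0.
Proof. by rewrite -[1]/(nproj 1) nskew_proj tskew1 linear0. Qed.

Lemma nskew_gen l i : nskew l (nproj (tgen i)) = (i == l)%:R.
Proof.
rewrite nskew_proj -[tgen i]mulr1 tskew_genM tskew1 mulr0 add0r tact_one.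
by rewrite linearZ /= -[nproj 1]/(1 : B) scaler_nat.
Qed.

Lemma nskewM l (a b : B) : nskew l (a * b) = a * nskew l b + nskew l a * nact (val l) b.
Proof.
rewrite -[a]nreprK -[b]nreprK -nprojM !nskew_proj tskewM nact_proj.
by rewrite linearD /= !nprojM.
Qed.

Lemma nskew_act l t (b : B) :
  nskew (iact t l) (nact t b) = rd_chi D (val l) t *: nact t (nskew l b).
Proof.
by rewrite -[b]nreprK nact_proj !nskew_proj tskew_act nact_proj linearZ.
Qed.

Lemma nact_gen t (i : I) :
  nact t (nproj (tgen i) : B) = rd_chi D (val i) t *: nproj (tgen (iact t i)).
Proof. by rewrite nact_proj tgen_act linearZ. Qed.

(* Meaningful for words of length at most 1 only *)
Definition nfcoef (w : {fmonom I}) (b : B) : k := fcoef w (nrepr b).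

Section NCoef.
Variable w : {fmonom I}.
Hypothesis w2 : (size w < 2)%N.

Lemma nfcoef_proj a : nfcoef w (nproj a) = fcoef w a.
Proof.
have : nichols_ideal (nrepr (nproj a) - a) by exact: lrepr_proj.
move=> /(nc_ge2 (nichols_ideal_cand D)) /(_ w2).
rewrite -scaleN1r fcoefD fcoefZ mulN1r => /eqP.
by rewrite subr_eq0 => /eqP.
Qed.

Lemma nfcoef_linear : linear (nfcoef w : B -> k^o).
Proof.
move=> c x y; rewrite -[x]nreprK -[y]nreprK -(nproj_linear (D := D)) !nfcoef_proj.
exact: fcoef_linear.
Qed.

Lemma nfcoef_homog m b : nhomog m b -> size w != m -> nfcoef w b = 0.
Proof.
case=> a /= am <- wm; rewrite nfcoef_proj.
apply: (tcomp_ext (V := k^o) (f := fcoef w) (g := fun=> 0) _ _ am).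
- exact: fcoef_linear.
- by move=> c x y; rewrite scaler0 addr0.
by move=> u /= /eqP um; rewrite fcoef_bas; case: eqP => // uw; rewrite -uw um eqxx in wm.
Qed.

End NCoef.

Lemma bcoef_nfcoef_linear (w : {fmonom I}) t : (size w < 2)%N ->
  linear (fun h : boson D => nfcoef w (bcoef h t) : k^o).
Proof. by move=> w2 c x y; rewrite bcoefD bcoefZ nfcoef_linear. Qed.

(** Moves computations with the coproduct of B # 1 to the tensor algebra, where the counit axioms
    and coefficients of words are at hand. *)
Lemma bcopr_smash_proj (a : T) : bcopr (smash (nproj a) 1%g) =
  tlift (fun u v : T => \sum_(g : 'S_n)
    tprod (smash (nproj u : B) g) (smash (nproj (tcoact g v) : B) 1%g)) (tcopr a).
Proof.
rewrite bcopr_smash ncopr_proj; move: (tcopr a).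
have sl t : linear ((@smash k n D)^~ t) := @smash_linear _ _ _ t.
have pl := @nproj_linear k n D.
have gl (v : T) : linear (fun u : T => tprod (nproj u : B) (nproj v : B)) := lin_comp pl (tprod_linl _).
have gr (u : T) : linear (fun v : T => tprod (nproj u : B) (nproj v : B)) := lin_comp pl (tprod_linr _).
have fl (b : B) : linear (fun x : B => \sum_(g : 'S_n)
    tprod (smash x (Defs.pcomp g 1%g)) (smash (ncoact g b) 1%g)).
  by apply: lin_sum => g; exact: lin_comp (sl _) (tprod_linl _).
have fr (x : B) : linear (fun b : B => \sum_(g : 'S_n)
    tprod (smash x (Defs.pcomp g 1%g)) (smash (ncoact g b) 1%g)).
  apply: lin_sum => g; apply: (lin_comp _ (tprod_linr _)).
  exact: lin_comp (@ncoact_linear _ _ _ g) (sl _).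
have hl (v : T) : linear (fun u : T => \sum_(g : 'S_n)
    tprod (smash (nproj u : B) g) (smash (nproj (tcoact g v) : B) 1%g)).
  apply: lin_sum => g; apply: (lin_comp _ (tprod_linl _)); exact: lin_comp pl (sl _).
have hr (u : T) : linear (fun v : T => \sum_(g : 'S_n)
    tprod (smash (nproj u : B) g) (smash (nproj (tcoact g v) : B) 1%g)).
  apply: lin_sum => g; apply: (lin_comp _ (tprod_linr _)); apply: (lin_comp _ (sl _)).
  exact: lin_comp (@tcomp_linear _ _ _ _) pl.
apply: tensor_linear_ext => [||u v].
- exact: lin_comp (tlift_linear gl gr) (tlift_linear fl fr).
- exact: tlift_linear hl hr.
rewrite (tlift_tprod gl gr) (tlift_tprod fl fr) (tlift_tprod hl hr).
by apply: eq_bigr => g _; rewrite /Defs.pcomp mul1g ncoact_proj.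
Qed.

Lemma fcoef_coact w g (v : T) : fcoef w (tcoact g v) = (wdeg w == g)%:R * fcoef w v.
Proof.
move: v; apply: (@free_ext k n D k^o) => [||u].
- have lw := fcoef_linear (k := k) w.
  exact: lin_comp (@tcomp_linear _ _ D (fun w => wdeg w == g)) lw.
- exact: (lin_scale (W := k^o) (wdeg w == g)%:R (fcoef_linear w)).
rewrite /tcoact tcomp_word fcoef_bas; case: (_ =P w) => [<-|/eqP/negPf uw] /=.
  by case: eqP => _; rewrite ?fcoef0 ?mulr1 ?fcoef_bas ?eqxx.
by rewrite mulr0; case: eqP; rewrite ?fcoef0 // fcoef_bas uw.
Qed.

End NicholsSkew.

(** * Homogeneous coideal subalgebras *)

Section CoidealLink.
Variables (k : fieldType) (n : nat) (D : rack_datum k n).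
Local Notation I := (rd_idx D).
Local Notation T := (fmod k {fmonom I}).
Local Notation B := (nichols D).
Local Notation H := (boson D).

Lemma smash0 t : smash (0 : B) t = 0.
Proof. exact: (lin0 (@smash_linear k n D t)). Qed.

Lemma smash_inj t : injective (fun b : B => smash b t).
Proof. by move=> a b /(congr1 ((@bcoef k n D)^~ t)); rewrite !smashE eqxx. Qed.

Lemma fmu_lt2 (l : I) : (size (fmu l : {fmonom I}) < 2)%N. Proof. by rewrite fmU. Qed.
Lemma mone_lt2 : (size (mone : {fmonom I}) < 2)%N. Proof. by rewrite fm1. Qed.

(** The group element [g] of a first factor records the S_n-degree of the second one. As x_l has
    degree l, reading its coefficient keeps only the term with g = l. *)
Lemma contr_bcopr (l : I) (b : B) :
  contr (fun h => nfcoef (fmu l) (bcoef h 1%g)) (bcopr (smash b 1%g)) =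
  smash (nskew l b) (val l).
Proof.
rewrite -[b]nreprK bcopr_smash_proj nskew_proj /tskew.
have lc := contr_linear (U := H) (bcoef_nfcoef_linear 1%g (fmu_lt2 l)).
have lt := contr_linear (U := T) (fcoef_linear (k := k) (fmu l)).
have pl := @nproj_linear k n D; have sl t := @smash_linear k n D t.
have hl (v : T) : linear (fun u : T => \sum_(g : 'S_n)
    tprod (smash (nproj u : B) g) (smash (nproj (tcoact g v) : B) 1%g)).
  apply: lin_sum => g; apply: (lin_comp _ (tprod_linl _)); exact: lin_comp pl (sl _).
have hr (u : T) : linear (fun v : T => \sum_(g : 'S_n)
    tprod (smash (nproj u : B) g) (smash (nproj (tcoact g v) : B) 1%g)).
  apply: lin_sum => g; apply: (lin_comp _ (tprod_linr _)); apply: (lin_comp _ (sl _)).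
  exact: lin_comp (@tcomp_linear _ _ _ _) pl.
move: (tcopr _); apply: tensor_linear_ext => [||u v].
- exact: lin_comp (tlift_linear hl hr) lc.
- exact: lin_comp lt (lin_comp pl (sl (val l))).
rewrite (tlift_tprod hl hr) (contr_tprod (fcoef_linear (k := k) (fmu l))).
rewrite (linZ _ _ pl) (linZ _ _ (sl _)).
rewrite (big_morph _ (fun x y => linD x y lc) (lin0 lc)) (bigD1 (val l)) //= big1 ?addr0.
  rewrite contr_tprod; last exact: (bcoef_nfcoef_linear 1%g (fmu_lt2 l)).
  rewrite smashE eqxx nfcoef_proj ?fmu_lt2 // fcoef_coact fmU /= /Defs.pcomp mul1g.
  by rewrite eqxx mul1r.
move=> g gl; rewrite contr_tprod; last exact: (bcoef_nfcoef_linear 1%g (fmu_lt2 l)).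
rewrite smashE eqxx nfcoef_proj ?fmu_lt2 // fcoef_coact fmU /= /Defs.pcomp mul1g.
by rewrite eq_sym (negPf gl) mul0r scale0r.
Qed.

(** The constant coefficient at [g] of the first factor applies the counit of [B] and selects the
    part of [b] whose coaction is [g]. *)
Lemma lcontr_bcopr g (b : B) :
  lcontr (fun h => nfcoef mone (bcoef h g)) (bcopr (smash b 1%g)) = smash (ncoact g b) 1%g.
Proof.
rewrite -[b]nreprK bcopr_smash_proj ncoact_proj -{2}[nrepr b]lcontr_counit.
have lc := lcontr_linear (W := H) (bcoef_nfcoef_linear g mone_lt2).
have lt := lcontr_linear (W := T) (fcoef_linear (k := k) (mone : {fmonom I})).
have pl := @nproj_linear k n D; have sl t := @smash_linear k n D t.
have cl g' := @tcomp_linear k n D (fun w => wdeg w == g').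
have hl (v : T) : linear (fun u : T => \sum_(g : 'S_n)
    tprod (smash (nproj u : B) g) (smash (nproj (tcoact g v) : B) 1%g)).
  apply: lin_sum => g'; apply: (lin_comp _ (tprod_linl _)); exact: lin_comp pl (sl _).
have hr (u : T) : linear (fun v : T => \sum_(g : 'S_n)
    tprod (smash (nproj u : B) g) (smash (nproj (tcoact g v) : B) 1%g)).
  apply: lin_sum => g'; apply: (lin_comp _ (tprod_linr _)); apply: (lin_comp _ (sl _)).
  exact: lin_comp (cl _) pl.
move: (tcopr _); apply: tensor_linear_ext => [||u v].
- exact: lin_comp (tlift_linear hl hr) lc.
- exact: lin_comp lt (lin_comp (cl g) (lin_comp pl (sl 1%g))).
rewrite (tlift_tprod hl hr) (lcontr_tprod (fcoef_linear (k := k) (mone : {fmonom I}))).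
rewrite /tcoact (linZ _ _ (cl g)) (linZ _ _ pl) (linZ _ _ (sl _)).
rewrite (big_morph _ (fun x y => linD x y lc) (lin0 lc)) (bigD1 g) //= big1 ?addr0.
  rewrite lcontr_tprod; last exact: (bcoef_nfcoef_linear g mone_lt2).
  by rewrite smashE eqxx nfcoef_proj ?mone_lt2.
move=> g' g'g; rewrite lcontr_tprod; last exact: (bcoef_nfcoef_linear g mone_lt2).
rewrite smashE eq_sym (negPf g'g) -(linear0 (@nproj k n D)) nfcoef_proj ?mone_lt2 //.
by rewrite fcoef0 scale0r.
Qed.

Variables (K : set H) (Km : nat -> set H).
Hypothesis hK : homogeneous_lcs K Km.
Hypothesis hK1 : forall x, K x -> exists b : B, x = smash b 1%g.

Lemma homog_sub m x : Km m x -> K x.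
Proof. by move=> Kx; rewrite (hl_sum hK); apply: span_incl; exists m. Qed.

(** The constant coefficient vanishes on first factors of positive degree, so contracting [hl_copr]
    with it leaves second factors in K(m). *)
Lemma homog_coact m g b : Km m (smash b 1%g) -> Km m (smash (ncoact g b) 1%g).
Proof.
move=> Kb; rewrite -lcontr_bcopr; have := hl_copr hK Kb.
have [K0 Kl] := hl_subspace hK m.
have lc := lcontr_linear (W := H) (bcoef_nfcoef_linear g mone_lt2).
elim=> [|c _ z [i [h [y [im hi Ky ->]]]] _ IH]; first by rewrite (lin0 lc).
rewrite (lc c (tprod h y) z); apply: (Kl c _ _ _ IH); rewrite lcontr_tprod; last first.
  exact: (bcoef_nfcoef_linear g mone_lt2).
case: i im hi Ky => [|i] im hi Ky.
  by rewrite subn0 in Ky; rewrite -[_ *: _]addr0; apply: Kl.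
by rewrite (nfcoef_homog mone_lt2 (hi g)) ?fm1 // scale0r.
Qed.

(** Distinct letters have distinct S_n-degrees, so the component of [b] of degree l is a multiple of
    x_l, by a nonzero scalar. *)
Lemma homog1_gen l b : Km 1%N (smash b 1%g) -> nfcoef (fmu l) b != 0 -> Km 1%N (bgen l).
Proof.
move=> Kb bl; have [K0 Kl] := hl_subspace hK 1.
have := hl_deg hK Kb 1%g; rewrite smashE eqxx => -[a /= a1 ab].
have e : ncoact (val l) b = nfcoef (fmu l) b *: nproj (tgen l).
  rewrite -ab ncoact_proj nfcoef_proj ?fmu_lt2 // -linearZ; congr nproj.
  apply: (tcomp_ext (f := tcoact (val l)) (g := fun a => fcoef (fmu l) a *: tgen l) _ _ a1).
  - exact: tcomp_linear.
  - by move=> c x y; rewrite fcoefD fcoefZ scalerDl scalerA.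
  case=> [|i [|? ?]] //= _; rewrite /tcoact tcomp_word /= /Defs.pcomp mul1g -fmuE fcoef_bas.
  rewrite (inj_eq val_inj); case: eqP => [->|il]; first by rewrite eqxx scale1r.
  case: eqP => [/(congr1 (@fmonom_val _))|_]; last by rewrite scale0r.
  by rewrite !fmU => -[/il].
have := homog_coact (val l) Kb; rewrite e => Kl'.
have := Kl (nfcoef (fmu l) b)^-1 _ _ Kl' K0.
by rewrite addr0 (linZ _ _ (@smash_linear k n D 1%g)) scalerA mulVf // scale1r.
Qed.

(** The second factors of the coproduct lie in [K]. Outside degree one they have no coefficient at
    x_l, and in degree one a nonzero coefficient would put x_l in K(1). *)
Lemma coideal_skew0 l b : ~ Km 1%N (bgen l) -> K (smash b 1%g) -> nskew l b = 0.
Proof.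
move=> Kl Kb; apply: (@smash_inj (val l)); rewrite -contr_bcopr smash0.
have lc := contr_linear (U := H) (bcoef_nfcoef_linear 1%g (fmu_lt2 l)).
have x0 m x : Km m x -> contr (fun h => nfcoef (fmu l) (bcoef h 1%g)) (bcopr x) = 0.
  move=> Kx; have := hl_copr hK Kx; elim=> [|d _ z [i [h [y [im hi Ky ->]]]] _ IHz].
    exact: lin0 lc.
  rewrite (lc d (tprod h y) z) IHz addr0 contr_tprod; last first.
    exact: (bcoef_nfcoef_linear 1%g (fmu_lt2 l)).
  have [b' yb] := hK1 (homog_sub Ky); rewrite yb smashE eqxx.
  suff -> : nfcoef (fmu l) b' = 0 by rewrite scale0r scaler0.
  case: (eqVneq (m - i)%N 1%N) => mi.
    by apply/eqP/negPn/negP => h0; case: Kl; apply: homog1_gen h0; rewrite -yb -mi.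
  have := hl_deg hK Ky 1%g; rewrite yb smashE eqxx => hb.
  by rewrite (nfcoef_homog (fmu_lt2 l) hb) // fmU eq_sym.
have lb := lin_comp (@bcopr_linear k n D) lc.
rewrite (hl_sum hK) in Kb.
(* The span of the empty set is the zero subspace; thus [span_map] extends the vanishing from
   homogeneous elements to [K]. *)
have : Defs.span (fun=> False) (contr (fun h => nfcoef (fmu l) (bcoef h 1%g)) (bcopr (smash b 1%g))).
  by apply: (span_map lb _ Kb) => x [m Kx]; rewrite (x0 m x Kx); left.
by case.
Qed.

Definition nichols_sub (Y : {set I}) : set B :=
  gen_subalgebra [set x | exists2 i, i \in Y & x = nproj (tgen i)].

(** The input specific to the four Nichols algebras, supplied by the certificates. *)
Hypothesis skew_sub : forall (Y : {set I}) b,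
  (forall l, l \notin Y -> nskew l b = 0) -> nichols_sub Y b.

Lemma KY_sub (Y : {set 'S_n}) b :
  nichols_sub [set i : I | val i \in Y]%SET b -> KY D Y (smash b 1%g).
Proof.
have sm (x y : B) : smash (x * y) 1%g = smash x 1%g * smash y 1%g.
  by rewrite smashM nact1 /Defs.pcomp mulg1.
move=> h S Ssub GS; apply: (h (fun b => S (smash b 1%g))) => [|x [i iY ->]].
  have [[S0 Sl] S1 SM] := Ssub; split=> //; first split.
  - by rewrite smash0.
  - by move=> c x y Sx Sy; rewrite smash_linear; apply: Sl.
  by move=> x y Sx Sy; rewrite sm; apply: SM.
by apply: GS; exists i => //; move: iY; rewrite inE.
Qed.

Lemma gen_subalgebraP (A : algType k) (G : set A) : is_subalgebra (gen_subalgebra G).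
Proof.
split; first split.
- by move=> S [[]].
- by move=> c x y Kx Ky S Ssub GS; have [[_ h] _ _] := Ssub; apply: h; [apply: Kx|apply: Ky].
- by move=> S [].
by move=> x y Kx Ky S Ssub GS; have [_ _ h] := Ssub; apply: h; [apply: Kx|apply: Ky].
Qed.

(** The kernel of d_l is a subalgebra containing every x_i with i different from l, but not x_l.
    Hence [Y] can be recovered from [KY D Y], which gives uniqueness. *)
Lemma KY_gen (Y : {set 'S_n}) l : KY D Y (bgen l) -> val l \in Y.
Proof.
move=> h; apply/negPn/negP => lY.
pose S : set H := fun x => exists2 b, x = smash b 1%g & nskew l b = 0.
have [] : S (bgen l); last first.
  move=> b /smash_inj <- /eqP; rewrite nskew_gen eqxx.
  by rewrite oner_eq0.
apply: h => [|x [i iY ->]]; last first.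
  exists (nproj (tgen i)) => //; rewrite nskew_gen; case: eqP => // il.
  by rewrite -il iY in lY.
split; first split.
- by exists 0; rewrite ?smash0 // (lin0 (@nskew_linear _ _ _ _)).
- move=> c _ _ [a -> a0] [b -> b0]; exists (c *: a + b); first by rewrite smash_linear.
  by rewrite nskew_linear a0 b0 scaler0 addr0.
- by exists 1 => //; exact: nskew1.
move=> _ _ [a -> a0] [b -> b0]; exists (a * b).
  by rewrite smashM nact1 /Defs.pcomp mulg1.
by rewrite nskewM a0 b0 mulr0 mul0r addr0.
Qed.

(** With [Y] the set of letters in K(1), [K] lies in [KY D Y] by [skew_sub], this lies in the
    subalgebra generated by K(1), and that one lies in [K]. *)
Lemma coideal_generated : K = gen_subalgebra (Km 1%N) /\
  exists! Y : {set 'S_n}, Y \subset rd_set D /\ K = KY D Y.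
Proof.
have [Ksub _] := hl_lcs hK.
pose Y : {set 'S_n} := [set val i | i in [set i : I | `[< Km 1%N (bgen i) >]]]%SET.
have YP i : (val i \in Y) = `[< Km 1%N (bgen i) >].
  by rewrite mem_imset ?inE //; exact: val_inj.
have KYg : (KY D Y `<=` gen_subalgebra (Km 1%N))%classic.
  move=> x h; apply: h; first exact: gen_subalgebraP.
  by move=> _ [i iY ->] S _; apply; apply/asboolP; rewrite -YP.
have gK : (gen_subalgebra (Km 1%N) `<=` K)%classic.
  by move=> x h; apply: (h K Ksub) => y; exact: homog_sub.
have KKY : (K `<=` KY D Y)%classic.
  move=> x Kx; have [b xb] := hK1 Kx; rewrite xb in Kx *.
  apply: (KY_sub (skew_sub _)) => l; rewrite inE YP => /asboolP Kl.
  exact: coideal_skew0 Kl Kx.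
have eK : K = KY D Y by apply/seteqP; split=> // x /KYg /gK.
split; first by apply/seteqP; split=> // x /KKY /KYg.
exists Y; split.
  by split=> //; apply/fintype.subsetP => _ /imsetP[i _ ->]; exact: (valP i).
have bK (Z : {set 'S_n}) (l : I) : val l \in Z -> KY D Z (bgen l) by move=> lZ S _; apply; exists l.
move=> Z [/fintype.subsetP ZD eZ]; apply/setP => s; apply/idP/idP => h.
  have [l _ e] := imsetP h; rewrite e in h *.
  by apply: KY_gen; rewrite -eZ eK; apply: bK.
have -> : s = val (exist _ s (ZD s h) : I) by [].
by apply: KY_gen; rewrite -eK eZ; apply: bK.
Qed.

End CoidealLink.

(** * The certificate checker *)

(* A signed word [(b, w)] stands for the monomial [(-1) ^ b x_w], where [x_w] is the product *)
(* of the generators with indices in [w]; a polynomial is a list of signed words.            *)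
Definition wpoly := seq (bool * seq nat).

Definition add_term (t : bool * seq nat) (p : wpoly) : wpoly :=
  if (~~ t.1, t.2) \in p then rem (~~ t.1, t.2) p else t :: p.

Definition collect (p : wpoly) : wpoly := foldr add_term [::] p.

Definition pmap_term (b : bool) (f : seq nat -> seq nat) (p : wpoly) : wpoly :=
  [seq (b (+) t.1, f t.2) | t <- p].

(* The rule [(w, p)] rewrites the word [w] to the polynomial [p]. *)
Definition rules := seq (seq nat * wpoly).

Definition rew_head (R : rules) (w : seq nat) : option wpoly :=
  ohead [seq pmap_term false (fun u => u ++ drop (size r.1) w) r.2 | r <- R & prefix r.1 w].

(** The leftmost reduction. Its difference from the rightmost one, [rew_right], is the source of new
    rules. *)
Fixpoint rew_left (R : rules) (w : seq nat) : option wpoly :=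
  if rew_head R w is Some p then Some p
  else if w is i :: w' then omap (pmap_term false (cons i)) (rew_left R w') else None.

Fixpoint rew_right (R : rules) (w : seq nat) : option wpoly :=
  if w is i :: w' then
    if rew_right R w' is Some p then Some (pmap_term false (cons i) p) else rew_head R w
  else None.

(** When the fuel runs out, the rest is returned unreduced, so the value in [B] is preserved in
    every case. *)
Fixpoint normalize (R : rules) (fuel : nat) (acc todo : wpoly) : wpoly :=
  if fuel is fuel'.+1 then
    if todo is t :: todo' then
      if rew_left R t.2 is Some p then
        normalize R fuel' acc (pmap_term t.1 id p ++ todo')
      else normalize R fuel' (add_term t acc) todo'
    else acc
  else acc ++ todo.

Fixpoint lex_lt (u v : seq nat) : bool :=
  match u, v with
  | i :: u', j :: v' => (i < j)%N || (i == j) && lex_lt u' v'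
  | _, _ => false
  end.

Definition lead (t : bool * seq nat) (p : wpoly) : bool * seq nat :=
  foldr (fun t u => if lex_lt u.2 t.2 then t else u) t p.

(* The division by a common multiplicity is where characteristic zero is used. *)
Definition primitive (p : wpoly) : wpoly :=
  if p is t :: _ then
    if all (fun u => count_mem u p == count_mem t p) p then undup p else p
  else p.

Definition add_rule (R : rules) (p : wpoly) : rules :=
  if primitive (normalize R 100 [::] p) is t :: q then
    let u := lead t q in (u.2, pmap_term (~~ u.1) id (rem u (t :: q))) :: R
  else R.

(* The S-polynomial of the two extreme reductions of [w] *)
Definition add_overlap (R : rules) (w : seq nat) : rules :=
  match rew_left R w, rew_right R w with
  | Some p, Some q => add_rule R (p ++ pmap_term true id q)
  | _, _ => R
  end.

(* The words [w_r], in decreasing order of degree and without the empty word, paired with *)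
(* the words [lambda_r] of the skew derivations separating them, and the words occurring   *)
(* in the relations that express the [w_r x_z] through the [w_s].                          *)
Record step := Step {
  st_sub : seq nat;
  st_new : nat;
  st_basis : seq (seq nat * seq nat);
  st_rels : seq (seq nat * seq (seq nat))
}.

Section Checker.
Variables (m : nat) (cj : nat -> nat -> nat) (sg : nat -> nat -> bool).

Fixpoint word_skew (l : nat) (w : seq nat) : wpoly :=
  if w is j :: w' then
    pmap_term false (cons j) (word_skew l w') ++
    (if j == l then [:: (odd (count (sg l) w'), map (cj l) w')] else [::])
  else [::].

Definition poly_skew (p : wpoly) (l : nat) : wpoly :=
  flatten [seq pmap_term t.1 id (word_skew l t.2) | t <- p].

Definition letters (w : seq nat) : bool := all (gtn m) w.

(* The orbit of [x_i (x) x_j] under [-c] *)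
Fixpoint braid_orbit (fuel : nat) (b : bool) (i j : nat) (stop : seq nat) : wpoly :=
  if fuel is fuel'.+1 then
    (b, [:: i; j]) ::
    (if [:: cj i j; i] == stop then [::]
     else braid_orbit fuel' (~~ (b (+) sg i j)) (cj i j) i stop)
  else [::].

Definition braid_next (t u : bool * seq nat) : bool :=
  if t.2 is [:: i; j] then u.2 == [:: cj i j; i] else false.

Definition quad_ok (p : wpoly) : bool :=
  [&& all (fun t => (size t.2 == 2%N) && letters t.2) p, sorted braid_next p
    & all (fun l => nilp (collect (poly_skew p l))) (iota 0 m)].

(** The orbits met here have at most three pairs, whence the fuel 3. An orbit sum is killed by 1 + c
    only if its signs close up, which [quad_ok] tests; an orbit met again normalizes to zero and
    adds no rule. *)
Definition quad_rules : rules :=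
  foldl add_rule [::]
    [seq p <- [seq braid_orbit 3 false i j [:: i; j] | i <- iota 0 m, j <- iota 0 m] | quad_ok p].

Fixpoint masks (n : nat) : seq bitseq :=
  if n is n'.+1 then [seq b :: s | b <- [:: true; false], s <- masks n'] else [:: [::]].

Section Step.
Variables (R : rules) (s : step).
Let Y := st_sub s.
Let Z := st_new s :: Y.
Let W := rcons (unzip1 (st_basis s)) [::].

(** Splitting off a prefix in the letters of [Y] places x_w in the left module K_Y x_v. *)
Definition decomposes (w : seq nat) : bool :=
  has (fun v => suffix v w && all (mem Y) (take (size w - size v) w)) W.

(** The signs of a relation are searched for, not recorded; so one certificate serves for both
    cocycles on the transpositions of S_4. *)
Definition rel_ok (r : seq nat * seq (seq nat)) : bool :=
  all decomposes r.2 &&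
  has (fun b => nilp (normalize R 100 [::] ((true, r.1) :: zip b r.2))) (masks (size r.2)).

Fixpoint dual_ok (V : seq (seq nat * seq nat)) : bool :=
  if V is (w, lam) :: V' then
    [&& letters w, letters lam, lam != [::], all (fun l => l \notin Y) lam,
     (if collect (foldl poly_skew [:: (false, w)] lam) is [:: (_, [::])] then true else false),
     nilp (collect (foldl poly_skew [:: (false, [::])] lam)),
     all (fun v => nilp (collect (foldl poly_skew [:: (false, v.1)] lam))) V' & dual_ok V']
  else true.

Definition step_ok : bool :=
  [&& all (gtn m) Z, all rel_ok (st_rels s), dual_ok (st_basis s) &
   all (fun w => all (fun z => decomposes (rcons w z) || (rcons w z \in unzip1 (st_rels s))) Z) W].

End Step.

Definition norm_sub (Y : seq nat) : seq nat := [seq i <- iota 0 m | i \in Y].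

Definition conj_close (G : seq (seq nat)) : seq (seq nat) :=
  undup (G ++ [seq [seq i <- iota 0 m | cj j i \in Y] | Y <- G, j <- iota 0 m]).

(** [G] lists the subsets already settled. A step descends from one of them, and six rounds of
    conjugation spread the new subset over its orbit. *)
Definition add_step (R : rules) (G : seq (seq nat)) (s : step) : seq (seq nat) :=
  if step_ok R s && (norm_sub (st_new s :: st_sub s) \in G) then
    iter 6 conj_close (norm_sub (st_sub s) :: G)
  else G.

Fixpoint sublists (s : seq nat) : seq (seq nat) :=
  if s is i :: s' then map (cons i) (sublists s') ++ sublists s' else [:: [::]].

Definition check (overlaps : seq (seq nat)) (steps : seq step) : bool :=
  let R := foldl add_overlap quad_rules overlaps in
  let G := foldl (add_step R) [:: iota 0 m] steps in
  all (fun Y => Y \in G) (sublists (iota 0 m)).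

End Checker.

(** * Soundness of the checker *)

Section CheckerSoundness.
Variables (k : fieldType) (n : nat) (D : rack_datum k n).
Local Notation I := (rd_idx D).
Local Notation T := (fmod k {fmonom I}).
Local Notation B := (nichols D).
Local Notation word w := (fbas (FMonom w) : T).

Hypothesis char0 : [pchar k] =i pred0.
Variables (m : nat) (cj : nat -> nat -> nat) (sg : nat -> nat -> bool) (e : nat -> I).
Hypothesis e_inj : forall i j, (i < m)%N -> (j < m)%N -> e i = e j -> i = j.
Hypothesis e_surj : forall l : I, exists2 i, (i < m)%N & e i = l.
Hypothesis cj_lt : forall i j, (i < m)%N -> (j < m)%N -> (cj i j < m)%N.
Hypothesis e_cj : forall i j, (i < m)%N -> (j < m)%N -> e (cj i j) = iact (val (e i)) (e j).
Hypothesis e_sg : forall i j, (i < m)%N -> (j < m)%N ->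
  rd_chi D (val (e j)) (val (e i)) = (-1) ^+ sg i j.

Local Notation letters := (letters m).

Let pl := @nproj_linear k n D.

Definition evw (w : seq nat) : T := word (map e w).
Definition evp (p : wpoly) : T := \sum_(t <- p) (-1) ^+ t.1 *: evw t.2.

Lemma evp_cons t p : evp (t :: p) = (-1) ^+ t.1 *: evw t.2 + evp p.
Proof. by rewrite /evp big_cons. Qed.

Lemma evp_cat p q : evp (p ++ q) = evp p + evp q.
Proof. by rewrite /evp big_cat. Qed.

Lemma evp0 : evp [::] = 0. Proof. exact: big_nil. Qed.

Lemma evw_cat u v : evw (u ++ v) = evw u * evw v.
Proof. by rewrite /evw map_cat word_cat. Qed.

Lemma evw_cons i w : evw (i :: w) = tgen (e i) * evw w.
Proof. exact: word_cons. Qed.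

Lemma evw0 : evw [::] = 1. Proof. exact: word0. Qed.

Lemma signZ (V : lmodType k) (b c : bool) (v : V) :
  (-1) ^+ b *: ((-1) ^+ c *: v) = (-1) ^+ (b (+) c) *: v.
Proof. by rewrite scalerA signr_addb. Qed.

Lemma evp_pmap b f p (F : T -> T) : linear F -> (forall w, evw (f w) = F (evw w)) ->
  evp (pmap_term b f p) = (-1) ^+ b *: F (evp p).
Proof.
move=> lF fF; elim: p => [|t p IH]; first by rewrite !evp0 (lin0 lF) scaler0.
by rewrite /= !evp_cons IH (linD _ _ lF) (linZ _ _ lF) scalerDr signZ /= fF.
Qed.

Lemma evp_sign b p : evp (pmap_term b id p) = (-1) ^+ b *: evp p.
Proof. exact: (@evp_pmap b id p (fun x => x)). Qed.

Lemma evp_rem t p : t \in p -> evp p = (-1) ^+ t.1 *: evw t.2 + evp (rem t p).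
Proof. by move=> tp; rewrite -evp_cons /evp (perm_big _ (perm_to_rem tp)). Qed.

Lemma evp_add_term t p : evp (add_term t p) = (-1) ^+ t.1 *: evw t.2 + evp p.
Proof.
rewrite /add_term; case: ifP => [tp|_]; last by rewrite evp_cons.
rewrite [in RHS](evp_rem tp) /= addrA -scalerDl.
by rewrite signrN subrr scale0r add0r.
Qed.

Lemma evp_collect p : evp (collect p) = evp p.
Proof. by elim: p => [|t p IH] //=; rewrite evp_add_term IH evp_cons. Qed.

Lemma evp_nil_collect p : nilp (collect p) -> evp p = 0.
Proof. by rewrite -evp_collect => /nilP ->; exact: evp0. Qed.

Lemma tact_evw l w : (l < m)%N -> letters w ->
  tact (val (e l)) (evw w) = (-1) ^+ odd (count (sg l) w) *: evw (map (cj l) w).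
Proof.
move=> lm; elim: w => [|j w IH] /=; first by rewrite evw0 tact_one scale1r.
move=> /andP[jm wm]; rewrite !evw_cons tactM IH // tgen_act e_sg // e_cj //.
by rewrite -scalerAl -scalerAr signZ oddD; case: (sg l j).
Qed.

Lemma tskew_evw l w : (l < m)%N -> letters w ->
  tskew (e l) (evw w) = evp (word_skew cj sg l w).
Proof.
move=> lm; elim: w => [|j w IH] /=; first by rewrite evw0 tskew1 evp0.
move=> /andP[jm wm]; rewrite evw_cons tskew_genM IH // evp_cat.
rewrite (evp_pmap _ _ (mulr_linear (tgen (e j)))) => [|u]; last exact: evw_cons.
rewrite scale1r; congr (_ + _).
case: (j =P l) => [->|jl]; last first.
  by rewrite evp0; case: eqP => [/e_inj jl'|_]; [case: jl; apply: jl'|rewrite scale0r].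
by rewrite eqxx scale1r evp_cons evp0 addr0 tact_evw.
Qed.

Lemma letters_skew l w : (l < m)%N -> letters w ->
  all (fun t => letters t.2) (word_skew cj sg l w).
Proof.
move=> lm; elim: w => [|j w IH] //= /andP[jm wm]; rewrite all_cat all_map.
apply/andP; split.
  by apply: sub_all (IH wm) => t tm; apply/andP.
case: eqP => //= _; rewrite andbT; apply/allP => _ /mapP[i iw ->].
by apply: cj_lt => //; apply: (allP wm).
Qed.

Lemma tskew_evp l p : (l < m)%N -> all (fun t => letters t.2) p ->
  tskew (e l) (evp p) = evp (poly_skew cj sg p l).
Proof.
move=> lm; elim: p => [|t p IH] /=; first by rewrite evp0 (lin0 (@tskew_linear _ _ _ _)).
move=> /andP[tm pm]; rewrite evp_cons (linD _ _ (@tskew_linear _ _ _ _)).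
rewrite (linZ _ _ (@tskew_linear _ _ _ _)) IH // tskew_evw //.
by rewrite /poly_skew /= evp_cat evp_sign.
Qed.

Lemma letters_poly_skew l p : (l < m)%N -> all (fun t => letters t.2) p ->
  all (fun t => letters t.2) (poly_skew cj sg p l).
Proof.
move=> lm; elim: p => [|t p IH] //= /andP[tm pm].
rewrite /poly_skew /= all_cat IH // andbT all_map.
exact: letters_skew.
Qed.

Definition nskews (lam : seq nat) (b : B) : B := foldl (fun b l => nskew (e l) b) b lam.

Lemma nskews_evp lam p : letters lam -> all (fun t => letters t.2) p ->
  nskews lam (nproj (evp p)) = nproj (evp (foldl (poly_skew cj sg) p lam)).
Proof.
elim: lam p => [|l lam IH] p //= /andP[lm lamm] pm.
by rewrite nskew_proj tskew_evp // IH // letters_poly_skew.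
Qed.

Lemma nskews_linear lam : linear (nskews lam).
Proof.
elim: lam => [|l lam IH] c x y //=.
by rewrite /nskews /= nskew_linear -/(nskews _ _) IH.
Qed.

Definition valid (R : rules) : Prop :=
  forall r, r \in R -> nproj (evw r.1) = nproj (evp r.2) :> B.

Lemma rew_headP R w p : valid R -> rew_head R w = Some p -> nproj (evw w) = nproj (evp p) :> B.
Proof.
move=> vR; rewrite /rew_head; set s := [seq r <- R | _].
case es: s => [|r s'] //= -[<-].
have : r \in s by rewrite es mem_head.
rewrite mem_filter => /andP[/prefixP[v ->] /vR er].
rewrite drop_size_cat // evw_cat nprojM er -nprojM.
rewrite (evp_pmap false _ (mull_linear (evw v))) ?scale1r // => u.
exact: evw_cat.
Qed.

Lemma evp_lmul i p : evp (pmap_term false (cons i) p) = tgen (e i) * evp p.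
Proof.
rewrite (evp_pmap _ _ (mulr_linear (tgen (e i)))) ?scale1r // => u; exact: evw_cons.
Qed.

Lemma rew_leftP R w p : valid R -> rew_left R w = Some p -> nproj (evw w) = nproj (evp p) :> B.
Proof.
move=> vR; elim: w p => [|i w IH] p /=; case e1: (rew_head R _) => [q|] //.
- by move=> [<-]; apply: rew_headP e1.
- by move=> [<-]; apply: rew_headP e1.
case e2: (rew_left R w) => [q|] //= -[<-].
by rewrite evp_lmul evw_cons !nprojM (IH _ e2).
Qed.

Lemma rew_rightP R w p : valid R -> rew_right R w = Some p -> nproj (evw w) = nproj (evp p) :> B.
Proof.
move=> vR; elim: w p => [|i w IH] p //=.
case e2: (rew_right R w) => [q|]; last exact: rew_headP.
by move=> [<-]; rewrite evp_lmul evw_cons !nprojM (IH _ e2).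
Qed.

Lemma normalizeP R fuel acc todo : valid R ->
  nproj (evp (normalize R fuel acc todo)) = nproj (evp acc + evp todo) :> B.
Proof.
move=> vR; elim: fuel acc todo => [|fuel IH] acc todo /=; first by rewrite evp_cat.
case: todo => [|t todo]; first by rewrite evp0 addr0.
case e1: (rew_left R t.2) => [p|]; rewrite IH; last first.
  by rewrite evp_add_term evp_cons [in RHS]addrCA addrA.
by rewrite evp_cat evp_sign evp_cons !(linD _ _ pl) !(linZ _ _ pl) (rew_leftP vR e1).
Qed.

Lemma normalize0 R fuel p : valid R -> nilp (normalize R fuel [::] p) ->
  nproj (evp p) = 0 :> B.
Proof.
move=> vR /nilP h; have := normalizeP fuel [::] p vR.
by rewrite h evp0 add0r (lin0 pl) => <-.
Qed.

Lemma lead_mem t p : lead t p \in t :: p.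
Proof.
elim: p => [|u p IH] /=; first exact: mem_head.
case: ifP => _; first by rewrite !inE eqxx orbT.
by move: IH; rewrite !inE => /orP[->|->] //; rewrite !orbT.
Qed.

Lemma primitive_eq0 p : nproj (evp p) = 0 :> B -> nproj (evp (primitive p)) = 0 :> B.
Proof.
case: p => [|t q] //; rewrite /primitive; set p := t :: q; case: ifP => // /allP pc p0.
pose c := count_mem t p.
have ep : evp p = c%:R *: evp (undup p).
  rewrite /evp -big_undup_iterop_count scaler_sumr big_seq [RHS]big_seq.
  by apply: eq_bigr => u; rewrite mem_undup => /pc /eqP ->; rewrite scaler_nat.
move/eqP: p0; rewrite ep (linZ _ _ pl) scaler_eq0 => /orP[|/eqP //].
by rewrite ((pcharf0P k).1 char0) /c /= eqxx.
Qed.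

Lemma add_rule_valid R p : valid R -> nproj (evp p) = 0 :> B -> valid (add_rule R p).
Proof.
move=> vR p0; rewrite /add_rule; have := normalizeP 100 [::] p vR.
rewrite evp0 add0r p0 => /primitive_eq0.
case: (primitive _) => [|t q] // h r; rewrite inE => /orP[/eqP ->|/vR] //=.
move: h; rewrite (evp_rem (lead_mem t q)).
move: (lead t q) => u; rewrite evp_sign (linD _ _ pl) !(linZ _ _ pl).
move: (nproj _) (nproj _) => b a h.
have -> : a = (-1) ^+ u.1 *: ((-1) ^+ u.1 *: a) by rewrite signZ addbb scale1r.
move/eqP: h; rewrite addr_eq0 => /eqP ->.
by rewrite signrN scaleNr scalerN.
Qed.

Lemma add_overlap_valid R w : valid R -> valid (add_overlap R w).
Proof.
move=> vR; rewrite /add_overlap; case el: (rew_left R w) => [p|] //.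
case er: (rew_right R w) => [q|] //; apply: add_rule_valid => //.
rewrite evp_cat evp_sign (linD _ _ pl) (linZ _ _ pl) -(rew_leftP vR el) -(rew_rightP vR er).
by rewrite expr1 scaleN1r subrr.
Qed.

(** The S_n-degree is constant along an orbit of the braiding because (i j i^-1) i = i j; with the
    vanishing of the skew derivations this makes a quadratic relation. *)
Lemma quad_okP p : quad_ok m cj sg p -> nproj (evp p) = 0 :> B.
Proof.
move=> /and3P[p2 ps pk]; case: p p2 ps pk => [|t p] p2 ps pk; first by rewrite evp0 (lin0 pl).
apply: quad_rel_nproj; exists (wdeg (map e t.2)) => [|l]; last first.
  have [i im <-] := e_surj l.
  rewrite tskew_evp //; last by apply: sub_all p2 => u /andP[].
  by apply: evp_nil_collect; apply: (allP pk); rewrite mem_iota.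
have hp : all (fun u => (size u.2 == 2%N) && (wdeg (map e u.2) == wdeg (map e t.2))) (t :: p).
  elim: p t ps p2 {pk} => [|u p IH] t /=; first by rewrite eqxx => _ /andP[/andP[-> _] _].
  move=> /andP[tu up] /and3P[/andP[t2 tm] u2 p2].
  have eu : wdeg (map e u.2) = wdeg (map e t.2).
    move: tu t2 tm; rewrite /braid_next; case: (t.2) => [|i [|j [|? ?]]] //= /eqP -> _.
    rewrite andbT => /andP[im jm] /=; rewrite e_cj //= /Defs.pcomp !mul1g.
    by rewrite conjgE mulgA mulgV mul1g.
  have := IH u up; rewrite /= u2 p2 => /(_ isT) /andP[_ ph].
  case/andP: u2 => u2 _; apply/and3P; split; rewrite ?t2 ?u2 ?eu ?eqxx //.
  by rewrite -eu.
rewrite /evp; move: hp; move: (t :: p) (wdeg _) => {p2 ps pk} q g.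
elim: q => [|u q IH] /=; first by rewrite big_nil linear0.
move=> /andP[/andP[u2 ug] qh]; rewrite big_cons linearD linearZ /= IH // /evw.
by rewrite tcomp_word /deg2 /= size_map u2 ug.
Qed.

Lemma quad_rules_valid : valid (quad_rules m cj sg).
Proof.
rewrite /quad_rules; set s := [seq p <- _ | _].
have : forall p, p \in s -> nproj (evp p) = 0 :> B.
  by move=> p; rewrite mem_filter => /andP[/quad_okP].
have : valid [::] by [].
elim: s [::] => [|p s IH] R vR //= hs; apply: IH => [|q qs].
  by apply: add_rule_valid => //; apply: hs; rewrite mem_head.
by apply: hs; rewrite inE qs orbT.
Qed.

(** * Subalgebras generated by some of the letters, and left modules over them *)

Definition nsub (Y : seq nat) : set B :=
  gen_subalgebra [set x | exists2 i, i \in Y & x = nproj (tgen (e i))].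

(** The property that descends from larger to smaller [Y]. *)
Definition separated (Y : seq nat) : Prop := forall b,
  (forall i, (i < m)%N -> i \notin Y -> nskew (e i) b = 0) -> nsub Y b.

Lemma nsub_gen Y i : i \in Y -> nsub Y (nproj (tgen (e i))).
Proof. by move=> iY S _; apply; exists i. Qed.

Lemma nsub_alg Y : is_subalgebra (nsub Y).
Proof. exact: gen_subalgebraP. Qed.

Lemma nsubZ Y c a : nsub Y a -> nsub Y (c *: a).
Proof.
move=> Ya; have [[h0 hl] _ _] := nsub_alg Y; rewrite -[_ *: _]addr0; exact: hl.
Qed.

Lemma nsub_evw Y w : all (mem Y) w -> nsub Y (nproj (evw w)).
Proof.
have [_ h1 hM] := nsub_alg Y.
elim: w => [|i w IH] /=; first by rewrite evw0.
by move=> /andP[iY wY]; rewrite evw_cons nprojM; apply: hM; [exact: nsub_gen|exact: IH].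
Qed.

Lemma nsub_sub Y Y' : {subset Y <= Y'} -> (nsub Y `<=` nsub Y')%classic.
Proof.
move=> sY b; apply; first exact: nsub_alg.
by move=> _ [i iY ->]; apply: nsub_gen; apply: sY.
Qed.

Lemma separated_eq Y Y' : Y =i Y' -> separated Y -> separated Y'.
Proof.
move=> eY sY b hb; apply: (nsub_sub (Y := Y)) => [i|]; first by rewrite eY.
by apply: sY => i im; rewrite eY; apply: hb.
Qed.

Lemma nsub_nskew0 Y l a : (l < m)%N -> all (gtn m) Y -> l \notin Y -> nsub Y a ->
  nskew (e l) a = 0.
Proof.
move=> lm Ym lY Ya.
apply: (Ya (fun a => nskew (e l) a = 0)) => [|_ [i iY ->]].
  split; first split.
  - exact: (lin0 (@nskew_linear _ _ _ _)).
  - by move=> c x y x0 y0; rewrite nskew_linear x0 y0 scaler0 addr0.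
  - exact: nskew1.
  by move=> x y x0 y0; rewrite nskewM x0 y0 mulr0 mul0r addr0.
have im : (i < m)%N := allP Ym _ iY.
by rewrite nskew_gen; case: eqP => // /(e_inj im lm) il; rewrite -il iY in lY.
Qed.

(** Skew derivations along letters outside [Y] kill K_Y, so the twisted term of the Leibniz rule
    disappears. *)
Lemma nskews_nsub Y lam a b : all (gtn m) Y -> letters lam -> all (fun l => l \notin Y) lam ->
  nsub Y a -> nskews lam (a * b) = a * nskews lam b.
Proof.
move=> Ym + + Ya; elim: lam b => [|l lam IH] b //= /andP[lm lamm] /andP[lY lamY].
rewrite /nskews /= nskewM (nsub_nskew0 lm Ym lY Ya) mul0r addr0.
exact: IH.
Qed.

(* The left [nsub Y]-module spanned by the words in [W] *)
Fixpoint lspan (Y : seq nat) (W : seq (seq nat)) (b : B) : Prop :=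
  if W is w :: W' then exists2 a, nsub Y a & lspan Y W' (b - a * nproj (evw w)) else b = 0.

Section LeftSpan.
Variable Y : seq nat.

Let Y0 : nsub Y 0. Proof. by have [[]] := nsub_alg Y. Qed.

Lemma lspan0 W : lspan Y W 0.
Proof. by elim: W => [|w W IH] //=; exists 0 => //; rewrite mul0r subr0. Qed.

Lemma lspan_lin W c x y : lspan Y W x -> lspan Y W y -> lspan Y W (c *: x + y).
Proof.
have [[_ hl] _ _] := nsub_alg Y.
elim: W x y => [|w W IH] x y /=; first by move=> -> ->; rewrite scaler0 addr0.
move=> [a Ya ax] [a' Ya' ay]; exists (c *: a + a'); first exact: hl.
have -> : c *: x + y - (c *: a + a') * nproj (evw w) =
    c *: (x - a * nproj (evw w)) + (y - a' * nproj (evw w)).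
  by rewrite mulrDl scalerBr -scalerAl opprD addrACA.
exact: IH.
Qed.

Lemma lspanD W x y : lspan Y W x -> lspan Y W y -> lspan Y W (x + y).
Proof. by move=> Wx Wy; rewrite -[x]scale1r; apply: lspan_lin. Qed.

Lemma lspan_gen W w a : w \in W -> nsub Y a -> lspan Y W (a * nproj (evw w)).
Proof.
move=> + Ya; elim: W => [|v W IH] //=; rewrite inE => /orP[/eqP ->|wW].
  by exists a => //; rewrite subrr; apply: lspan0.
by exists 0 => //; rewrite mul0r subr0; apply: IH.
Qed.

Lemma lspan_ind W (P : B -> Prop) : P 0 -> (forall x y, P x -> P y -> P (x + y)) ->
  (forall a w, nsub Y a -> w \in W -> P (a * nproj (evw w))) -> forall b, lspan Y W b -> P b.
Proof.
move=> P0 PD; elim: W => [|w W IH] Pw b /=; first by move=> ->.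
move=> [a Ya /IH Pb]; rewrite -[b](subrK (a * nproj (evw w))); apply: PD.
  by apply: Pb => a' w' Ya' w'W; apply: Pw => //; rewrite inE w'W orbT.
by apply: Pw => //; rewrite mem_head.
Qed.

Lemma lspan_mull W a b : nsub Y a -> lspan Y W b -> lspan Y W (a * b).
Proof.
move=> Ya; have [_ _ hM] := nsub_alg Y.
apply: (lspan_ind (P := fun b => lspan Y W (a * b))) => [|x y hx hy|a' w Ya' wW];
  first by rewrite mulr0; apply: lspan0.
  by rewrite mulrDr; apply: lspanD.
by rewrite mulrA; apply: lspan_gen => //; apply: hM.
Qed.

(** The elements whose right multiplication preserves the left module form a subalgebra, which
    contains the letters of [Z]. Apply it to 1, which lies in the module through the empty word. *)
Lemma nsub_lspan Z W : [::] \in W ->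
  (forall w z, w \in W -> z \in Z -> lspan Y W (nproj (evw (rcons w z)))) ->
  (nsub Z `<=` lspan Y W)%classic.
Proof.
move=> W0 Wz.
suff h : (nsub Z `<=` (fun b => forall x, lspan Y W x -> lspan Y W (x * b)))%classic.
  move=> b /h /(_ 1); rewrite mul1r; apply.
  have := lspan_gen W0 (a := 1); rewrite evw0 mul1r; apply.
  by have [] := nsub_alg Y.
move=> b Zb; apply: (Zb (fun b => forall x, lspan Y W x -> lspan Y W (x * b))) => [|_ [z zZ ->] x].
  split; first split.
  - by move=> x _; rewrite mulr0; apply: lspan0.
  - by move=> c u v hu hv x Wx; rewrite mulrDr -scalerAr; apply: lspan_lin; [apply: hu|apply: hv].
  - by move=> x; rewrite mulr1.
  by move=> u v hu hv x Wx; rewrite mulrA; apply/hv/hu.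
apply: (lspan_ind (P := fun x => lspan Y W (x * nproj (tgen (e z))))) => [|u v hu hv|a w Ya wW];
  first by rewrite mul0r; apply: lspan0.
  by rewrite mulrDl; apply: lspanD.
rewrite -mulrA; apply: lspan_mull => //.
have := Wz w z wW zZ; rewrite -cats1 evw_cat nprojM evw_cons evw0 mulr1.
by [].
Qed.

End LeftSpan.

(** * Soundness of one step of the descent *)

Section StepSoundness.
Variables (R : rules) (s : step).
Hypothesis vR : valid R.
Local Notation Y := (st_sub s).
Local Notation W := (rcons (unzip1 (st_basis s)) [::]).

Lemma decomposesP w : decomposes s w -> lspan Y W (nproj (evw w)).
Proof.
move=> /hasP[v vW /andP[/suffixP[u ->]]].
rewrite size_cat addnK take_size_cat // evw_cat nprojM => uY.
by apply: lspan_gen => //; apply: nsub_evw.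
Qed.

Lemma rel_okP r : rel_ok R s r -> lspan Y W (nproj (evw r.1)).
Proof.
move=> /andP[rd /hasP[b _ h]]; have := normalize0 vR h.
rewrite evp_cons (linD _ _ pl) (linZ _ _ pl) expr1 scaleN1r addrC => /eqP; rewrite subr_eq0 => /eqP <-.
rewrite /evp; elim: (r.2) b rd {h} => [|w ws IH] [|c b] //=.
- by rewrite big_nil (lin0 pl) => _; apply: lspan0.
- by rewrite big_nil (lin0 pl) => _; apply: lspan0.
- by rewrite big_nil (lin0 pl) => _; apply: lspan0.
move=> /andP[wd wsd]; rewrite big_cons (linD _ _ pl) (linZ _ _ pl); apply: lspan_lin; last exact: IH.
exact: decomposesP.
Qed.

(** Apply the derivations along [lam] to [b], written as [a] times the first word plus later terms.
    They kill [b], as the first letter of [lam] is outside [Y]; they kill the later words and the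
    empty one, and send the first word to a sign. Hence [a] is zero. At the end only the coefficient
    of the empty word is left. *)
Lemma dual_okP (V : seq (seq nat * seq nat)) b : all (gtn m) Y -> dual_ok m cj sg s V ->
  all (fun v => letters v.1) V ->
  (forall i, (i < m)%N -> i \notin Y -> nskew (e i) b = 0) ->
  lspan Y (rcons (unzip1 V) [::]) b -> nsub Y b.
Proof.
move=> Ym; elim: V b => [|[w lam] V IH] b /=.
  by move=> _ _ _ [a Ya /eqP]; rewrite evw0 mulr1 subr_eq0 => /eqP ->.
move=> /and5P[wm lamm lam0 lamY] /and4P[dw d0 dV Vok] /andP[_ Vm] hb [a Ya hW].
have sV u : letters u -> nskews lam (nproj (evw u)) =
    nproj (evp (collect (foldl (poly_skew cj sg) [:: (false, u)] lam))).
  move=> um; rewrite evp_collect -nskews_evp //=; last by rewrite um.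
  by rewrite evp_cons evp0 addr0 scale1r.
have hb0 : nskews lam b = 0.
  case: lam lam0 lamm lamY {sV dw d0 dV} => [|l lam] // _ /= /andP[lm _] /andP[lY _].
  rewrite /nskews /= hb //; exact: (lin0 (nskews_linear lam)).
have hW0 : nskews lam (b - a * nproj (evw w)) = 0.
  move: hW; apply: (lspan_ind (P := fun x => nskews lam x = 0)) => [|x y x0 y0|a' v Ya' vV].
  - exact: (lin0 (nskews_linear lam)).
  - by rewrite (linD _ _ (nskews_linear lam)) x0 y0 addr0.
  rewrite (nskews_nsub _ Ym lamm lamY Ya').
  move: vV; rewrite mem_rcons inE => /orP[/eqP ->|/mapP[[v' l'] vV ->]] /=.
    by rewrite sV // (nilP d0) evp0 (lin0 pl) mulr0.
  by rewrite sV ?(allP Vm _ vV) // (nilP (allP dV _ vV)) evp0 (lin0 pl) mulr0.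
move: hW0; rewrite -scaleN1r addrC (nskews_linear lam) hb0 addr0.
rewrite (nskews_nsub _ Ym lamm lamY Ya) sV //.
case: (collect _) dw => [|[c [|? ?]] [|? ?]] // _.
rewrite evp_cons evp0 addr0 evw0 (linZ _ _ pl) -scalerAr mulr1 scalerA => /eqP.
rewrite scaler_eq0 mulN1r oppr_eq0 signr_eq0 => /eqP a0.
by apply: IH => //; move: hW; rewrite a0 mul0r subr0.
Qed.

Lemma dual_ok_letters V : dual_ok m cj sg s V -> all (fun v => letters v.1) V.
Proof. by elim: V => [|[w lam] V IH] //= /and5P[-> _ _ _ /and4P[_ _ _ /IH]]. Qed.

(** An element killed outside [Y] is also killed outside the larger set, hence lies in the larger
    subalgebra. The relations place it in the left module of the words, and [dual_okP] brings it
    down to K_Y. *)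
Lemma step_okP : step_ok m cj sg R s -> separated (st_new s :: Y) -> separated Y.
Proof.
move=> /and4P[Zm /allP rok dok /allP Wok] sZ b hb; have /andP[_ Ym] := Zm.
apply: (dual_okP Ym dok (dual_ok_letters dok) hb).
apply: (nsub_lspan (Z := st_new s :: Y)); first by rewrite mem_rcons mem_head.
  move=> w z wW zZ; have /orP[/decomposesP //|/mapP[r rs ->]] := allP (Wok w wW) z zZ.
  exact/rel_okP/rok.
by apply: sZ => i im; rewrite inE negb_or => /andP[_]; apply: hb.
Qed.

End StepSoundness.

(** The start of the descent: the letters generate [B]. *)
Lemma separated_all : separated (iota 0 m).
Proof.
move=> b _; rewrite -[b]nreprK; move: (nrepr b) => a.
have [[h0 hl] _ _] := nsub_alg (iota 0 m).
elim: (word_span a) => [|c _ y [w ->] _ IH]; first by rewrite linear0.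
rewrite linearP /=; apply: hl => //.
have [w' w'm ->] : exists2 w', letters w' & w = map e w'.
  elim: w => [|l w [w' w'm ->]]; first by exists [::].
  by have [i im <-] := e_surj l; exists (i :: w') => //=; rewrite im.
by apply: nsub_evw; apply: sub_all w'm => i im; rewrite inE mem_iota.
Qed.

(** The group element of x_j acts by an algebra automorphism that permutes letters and skew
    derivations up to scalars. It moves [b] into K_Y, and its inverse moves K_Y into the subalgebra
    of the preimage. *)
Lemma separated_conj j Y : (j < m)%N -> letters Y -> separated Y ->
  separated [seq i <- iota 0 m | cj j i \in Y].
Proof.
move=> jm Ym sY b hb; set Y' := [seq i <- _ | _].
have eY' i : (i < m)%N -> (i \in Y') = (cj j i \in Y).
  by move=> im; rewrite mem_filter mem_iota /= add0n im andbT.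
have {hb} Yb : nsub Y (nact (val (e j)) b).
  apply: sY => l lm lY; have [i im ei] := e_surj (iact (val (e j))^-1%g (e l)).
  have el : e l = iact (val (e j)) (e i).
    by rewrite ei; apply/val_inj; rewrite /= conjgKV.
  have il : cj j i = l by apply: (e_inj (cj_lt jm im) lm); rewrite e_cj.
  by rewrite el nskew_act hb ?linear0 ?scaler0 // eY' // il.
have -> : b = nact (val (e j))^-1%g (nact (val (e j)) b).
  by rewrite -nact_comp /Defs.pcomp mulgV nact1.
move: (nact _ b) Yb => x Yx.
apply: (Yx (fun x => nsub Y' (nact (val (e j))^-1%g x))).
  have [[h0 hl] h1 hM] := nsub_alg Y'; split; first split.
  - by rewrite linear0.
  - by move=> c u v Yu Yv; rewrite linearP; apply: hl.
  - by rewrite nact_one.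
  by move=> u v Yu Yv; rewrite nactM; apply: hM.
move=> _ [l lY ->]; rewrite nact_gen; apply: nsubZ.
have [i im ei] := e_surj (iact (val (e j))^-1%g (e l)); rewrite -ei.
apply: nsub_gen; rewrite eY' //; suff -> : cj j i = l by [].
apply: (e_inj (cj_lt jm im) (allP Ym _ lY)); rewrite e_cj // ei.
by apply/val_inj; rewrite /= conjgKV.
Qed.

Let good (G : seq (seq nat)) : Prop := forall Y, Y \in G -> letters Y /\ separated Y.

Let letters_filter (P : pred nat) : letters [seq i <- iota 0 m | P i].
Proof. by apply/allP => i; rewrite mem_filter mem_iota => /andP[_ /andP[]]. Qed.

Lemma conj_close_good G : good G -> good (conj_close m cj G).
Proof.
move=> gG Y; rewrite mem_undup mem_cat => /orP[/gG //|].
move=> /allpairsP[[Y' j] [/= /gG[Ym sY] + ->]]; rewrite mem_iota => /andP[_ jm].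
by split; [exact: letters_filter|exact: separated_conj].
Qed.

Lemma separated_norm Y : letters Y -> separated (norm_sub m Y) <-> separated Y.
Proof.
move=> Ym; have eY : norm_sub m Y =i Y.
  move=> i; rewrite mem_filter mem_iota /= add0n; case iY: (i \in Y) => //=.
  exact: (allP Ym).
by split; apply: separated_eq => // i; rewrite eY.
Qed.

Lemma add_step_good R G s : valid R -> good G -> good (add_step m cj sg R G s).
Proof.
move=> vR gG; rewrite /add_step; case: ifP => // /andP[ok /gG[_ sZ]].
have /andP[Zm _] := ok; have /andP[_ Ym] := Zm.
have sY : separated (st_sub s) by apply: step_okP vR ok _; apply/separated_norm.
have : good (norm_sub m (st_sub s) :: G).
  move=> Y; rewrite inE => /orP[/eqP ->|/gG //].
  by split; [exact: letters_filter|apply/separated_norm].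
by elim: 6%N => [|c IH] // g; apply: conj_close_good; apply: IH.
Qed.

Lemma sublists_filter (P : pred nat) s : [seq i <- s | P i] \in sublists s.
Proof.
elim: s => [|i s IH] //=; rewrite mem_cat; case: ifP => _; last by rewrite IH orbT.
by rewrite map_f.
Qed.

Lemma check_separated (P : pred nat) ov st : check m cj sg ov st ->
  separated [seq i <- iota 0 m | P i].
Proof.
have vR R : valid R -> valid (foldl add_overlap R ov).
  by elim: ov R => [|w ov' IH] R vR //=; exact/IH/add_overlap_valid.
have gS R G : valid R -> good G -> good (foldl (add_step m cj sg R) G st).
  by move=> vR'; elim: st G => [|s st' IH] G gG //=; exact/IH/add_step_good.
have g0 : good [:: iota 0 m].
  move=> Y; rewrite inE => /eqP ->; split; last exact: separated_all.
  by apply/allP => i; rewrite mem_iota => /andP[].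
move=> /allP /(_ _ (sublists_filter P _)) h.
by have [] := gS _ _ (vR _ quad_rules_valid) g0 _ h.
Qed.

Lemma check_skew_sub ov st (Y : {set I}) b : check m cj sg ov st ->
  (forall l, l \notin Y -> nskew l b = 0) -> nichols_sub Y b.
Proof.
move=> ck hb; have h := check_separated (P := fun i => e i \in Y) ck.
have /h : forall i, (i < m)%N -> i \notin [seq i <- iota 0 m | e i \in Y] -> nskew (e i) b = 0.
  by move=> i im; rewrite mem_filter mem_iota /= add0n im andbT; apply: hb.
apply; first exact: gen_subalgebraP.
move=> _ [i + ->] S _; rewrite mem_filter => /andP[iY _]; apply.
by exists (e i).
Qed.

End CheckerSoundness.

(** * Racks of permutations given by lists of images *)

(* Partial application lets the virtual machine evaluate the table only once. *)
Definition tabulate (T : Type) (m : nat) (f : nat -> nat -> T) : nat -> nat -> T :=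
  let t := [seq [seq f i j | j <- iota 0 m] | i <- iota 0 m] in
  fun i j => nth (f 0%N 0%N) (nth [::] t i) j.

Lemma tabulateE (T : Type) m (f : nat -> nat -> T) i j : (i < m)%N -> (j < m)%N ->
  tabulate m f i j = f i j.
Proof.
move=> im jm; rewrite /tabulate (nth_map 0%N) ?size_iota // (nth_map 0%N) ?size_iota //.
by rewrite !nth_iota.
Qed.

Definition img (l : seq nat) (x : nat) : nat := nth 0%N l x.

(* The list of images of [t s t^-1] from those of [t] and [s] *)
Definition conj_images (t s : seq nat) : seq nat :=
  [seq img t (img s (index x t)) | x <- iota 0 (size t)].

(** The letters of a certificate are positions in [ims], so the order of that list matters. *)
Definition rack_check (ims : seq (seq nat)) (sgn : seq nat -> seq nat -> bool)
    (ov : seq (seq nat)) (st : seq step) : bool :=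
  let m := size ims in
  let im := nth [::] ims in
  check m (tabulate m (fun i j => index (conj_images (im i) (im j)) ims))
    (tabulate m (fun i j => sgn (im i) (im j))) ov st.

Section Images.
Variable n : nat.
Implicit Types s t : 'S_n.

Definition images s : seq nat := [seq val (s x) | x <- enum 'I_n].

Lemma size_images s : size (images s) = n.
Proof. by rewrite size_map size_enum_ord. Qed.

Lemma imagesE s (x : 'I_n) : img (images s) x = s x.
Proof. by rewrite /img (nth_map x) ?size_enum_ord // nth_ord_enum. Qed.

Lemma images_inj : injective images.
Proof. by move=> s t e; apply/permP => x; apply/val_inj; rewrite /= -!imagesE e. Qed.

Lemma uniq_images s : uniq (images s).
Proof. by rewrite map_inj_uniq ?enum_uniq // => x y /val_inj /perm_inj. Qed.

Lemma perm_images s : perm_eq (images s) (iota 0 n).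
Proof.
apply: uniq_perm (uniq_images s) (iota_uniq _ _) _ => i; rewrite mem_iota /= add0n.
apply/mapP/idP => [[x _ ->]|im]; first exact: ltn_ord.
exists ((s^-1)%g (Ordinal im)); rewrite ?mem_enum //.
by rewrite permKV.
Qed.

Lemma images_conj s t : images (s ^ t)%g = conj_images (images t) (images s).
Proof.
apply: (@eq_from_nth _ 0%N) => [|i]; rewrite size_images.
  by rewrite size_map size_iota size_images.
move=> im; rewrite -[i]/(val (Ordinal im)); move: (Ordinal im) => x {i im}.
have xn : (val x < n)%N := ltn_ord x.
rewrite -/(img _ _) imagesE (nth_map 0%N) ?size_iota ?size_images //.
rewrite nth_iota ?size_images // add0n -{2}(permKV t x).
have -> : index (val (t ((t^-1)%g x))) (images t) = (t^-1)%g x.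
  by rewrite /= -imagesE /img index_uniq ?size_images ?uniq_images.
by rewrite !imagesE -[x in LHS](permKV t) permJ.
Qed.

Lemma images_surj l : perm_eq l (iota 0 n) -> exists s, images s = l.
Proof.
move=> pl; have sl : size l = n by rewrite (perm_size pl) size_iota.
have ul : uniq l by rewrite (perm_uniq pl) iota_uniq.
have ln (x : 'I_n) : (nth 0%N l x < n)%N.
  have : nth 0%N l x \in l by rewrite mem_nth // sl.
  by rewrite (perm_mem pl) mem_iota.
have fi : injective (fun x => Ordinal (ln x)).
  by move=> x y [/eqP]; rewrite nth_uniq ?sl // => /eqP /val_inj.
exists (perm fi); apply: (@eq_from_nth _ 0%N) => [|i]; rewrite size_images //.
move=> im; rewrite -[i]/(val (Ordinal im)) -/(img _ _) imagesE permE.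
by [].
Qed.

Definition transposition_images (p : nat * nat) : seq nat :=
  [seq if x == p.1 then p.2 else if x == p.2 then p.1 else x | x <- iota 0 n].

Definition increasing_pairs : seq (nat * nat) :=
  [seq p <- [seq (a, b) | a <- iota 0 n, b <- iota 0 n] | p.1 < p.2]%N.

Definition transpositions : seq (seq nat) := [seq transposition_images p | p <- increasing_pairs].

Lemma images_tperm (a b : 'I_n) : images (tperm a b) = transposition_images (val a, val b).
Proof.
apply: (@eq_from_nth _ 0%N) => [|i]; rewrite size_images ?size_map ?size_iota // => im.
rewrite (nth_map 0%N) ?size_iota // nth_iota // add0n.
rewrite -[i]/(val (Ordinal im)) -/(img _ _) imagesE permE /=.
by rewrite -!val_eqE /=; case: eqP => // _; case: eqP.
Qed.

Lemma increasing_pairsP (p : nat * nat) :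
  reflect (exists a b : 'I_n, (a < b)%N /\ p = (val a, val b)) (p \in increasing_pairs).
Proof.
rewrite mem_filter; apply: (iffP andP) => [[p12 /allpairsP[[a b] /= []]]|[a [b [ab ->]]]].
  rewrite !mem_iota /= !add0n => an bn ep; exists (Ordinal an), (Ordinal bn).
  by rewrite ep in p12 *.
by split=> //; apply: allpairs_f; rewrite mem_iota /=.
Qed.

Lemma tperm_cycles2 (a b : 'I_n) : a != b -> tperm a b \in cycles n 2.
Proof.
move=> ab; rewrite inE; apply/existsP; exists a.
have -> : porbit (tperm a b) a = [set a; b]%SET.
  apply/setP => x; rewrite !inE; apply/porbitP/orP => [[i ->]|].
    elim: i => [|i IH]; first by rewrite expg0 perm1; left.
    by rewrite expgSr permM; case: IH => /eqP ->; rewrite ?tpermL ?tpermR eqxx; [right|left].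
  case=> /eqP ->; first by exists 0%N; rewrite expg0 perm1.
  by exists 1%N; rewrite expg1 tpermL.
rewrite cards2 ab /=; apply/fintype.subsetP => x; rewrite !inE.
by case: tpermP => [->|->|//]; rewrite ?eqxx ?orbT.
Qed.

Lemma cycles2_images s : (s \in cycles n 2) = (images s \in transpositions).
Proof.
apply/idP/mapP => [/cycles2P[a [b [ab ->]]]|[_ /increasing_pairsP[a [b [ab ->]]]]].
  exists (val a, val b); last exact: images_tperm.
  by apply/increasing_pairsP; exists a, b.
rewrite -images_tperm => /images_inj ->; apply: tperm_cycles2.
by rewrite -val_eqE neq_ltn ab.
Qed.

Lemma odd_cycles2 s : s \in cycles n 2 -> odd_perm s.
Proof. by move=> /cycles2P[a [b [ab ->]]]; rewrite odd_tperm -val_eqE neq_ltn ab. Qed.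

Definition ord_sign (t s : seq nat) : bool :=
  has (fun p => (s == transposition_images p) && (img t p.2 < img t p.1)%N) increasing_pairs.

Lemma ord_chi_images (k : fieldType) s t :
  ord_chi k s t = (-1) ^+ ord_sign (images t) (images s).
Proof.
rewrite /ord_chi; set b := [exists a, _]; suff -> : b = ord_sign (images t) (images s).
  by case: ord_sign.
apply/existsP/hasP => [[x /existsP[y /and3P[xy /eqP -> txy]]]|].
  exists (val x, val y); first by apply/increasing_pairsP; exists x, y.
  by rewrite images_tperm eqxx /= !imagesE.
case=> _ /increasing_pairsP[x [y [xy ->]]] /andP[/eqP e /=]; rewrite !imagesE => txy.
exists x; apply/existsP; exists y; rewrite xy txy andbT /=.
by apply/eqP/images_inj; rewrite e images_tperm.
Qed.

End Images.

(** * The class of 4-cycles in S_4 *)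

Section FourCycles.
Implicit Types s : 'S_4.

Definition four_cycles : seq (seq nat) :=
  [:: [:: 1; 2; 3; 0]; [:: 1; 3; 0; 2]; [:: 3; 2; 0; 1];
      [:: 2; 0; 3; 1]; [:: 2; 3; 1; 0]; [:: 3; 0; 1; 2]]%N.

Lemma cycles4_porbit s x : s \in cycles 4 4 -> porbit s x = [set: 'I_4]%SET.
Proof.
rewrite inE => /existsP[y /andP[/eqP c4 _]].
have yT : porbit s y = [set: 'I_4]%SET.
  by apply/eqP; rewrite eqEcard finset.subsetT cardsT card_ord c4.
have : x \in porbit s y by rewrite yT inE.
by rewrite -eq_porbit_mem => /eqP ->.
Qed.

(** The sign is the parity of the number of points minus the number of orbits, here 4 - 1. *)
Lemma odd_cycles4 s : s \in cycles 4 4 -> odd_perm s.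
Proof.
move=> s4; rewrite /odd_perm card_ord.
suff -> : porbits s = [set [set: 'I_4]]%SET by rewrite cards1.
apply/setP => A; rewrite inE; apply/imsetP/eqP => [[x _ ->]|->]; first exact: cycles4_porbit.
by exists ord0; rewrite ?cycles4_porbit.
Qed.

(** Turns the class into a condition on the orbit of 0 that can be computed for all 24
    permutations. *)
Lemma cycles4_traject s : (s \in cycles 4 4) = uniq (traject s ord0 4).
Proof.
apply/idP/idP => [s4|us].
  have := uniq_traject_porbit s ord0.
  by rewrite cycles4_porbit // cardsT card_ord.
rewrite inE; apply/existsP; exists ord0.
have oT : porbit s ord0 = [set: 'I_4]%SET.
  apply/eqP; rewrite finset.eqEsubset finset.subsetT /= ; apply/fintype.subsetP => x _.
  have : x \in traject s ord0 4.
    have sT : {subset traject s ord0 4 <= enum 'I_4} by move=> y _; rewrite mem_enum.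
    have [|_ ->] := uniq_min_size us sT; first by rewrite size_enum_ord.
    by rewrite mem_enum.
  by move=> /trajectP[i _ ->]; rewrite -permX mem_porbit.
rewrite oT cardsT card_ord eqxx /=; apply/fintype.subsetP => x _.
by rewrite inE.
Qed.

Lemma cycles4_images s : (s \in cycles 4 4) = (images s \in four_cycles).
Proof.
have tr x i : map val (traject s x i) = traject (img (images s)) (val x) i.
  by elim: i x => [|i IH] x //=; rewrite IH imagesE.
rewrite cycles4_traject -(map_inj_uniq val_inj) tr.
have : all (fun l => uniq (traject (img l) 0%N 4) == (l \in four_cycles))
  (permutations (iota 0 4)) by vm_compute.
by move=> /allP /(_ (images s)); rewrite mem_permutations perm_images => /(_ isT)/eqP.
Qed.

End FourCycles.

(** * From the certificates to subsets of the rack *)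

Section RackCheck.
Variables (k : fieldType) (char0 : [pchar k] =i pred0) (n : nat) (D : rack_datum k n).
Variables (ims : seq (seq nat)) (sgn : seq nat -> seq nat -> bool).
Hypothesis ims_gt0 : (0 < size ims)%N.
Hypothesis ims_uniq : uniq ims.
Hypothesis ims_perm : all (perm_eq^~ (iota 0 n)) ims.
Hypothesis rdP : forall s, (s \in rd_set D) = (images s \in ims).
Hypothesis chiP : forall s t, s \in rd_set D -> t \in rd_set D ->
  rd_chi D s t = (-1) ^+ sgn (images t) (images s).

Lemma rack_check_skew_sub ov st (Y : {set rd_idx D}) b : rack_check ims sgn ov st ->
  (forall l, l \notin Y -> nskew l b = 0) -> nichols_sub Y b.
Proof.
rewrite /rack_check; set m := size ims; move=> ck.
have ex i : (i < m)%N -> exists l : rd_idx D, images (val l) = nth [::] ims i.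
  move=> im; have ii : nth [::] ims i \in ims by rewrite mem_nth.
  have [s es] := images_surj (allP ims_perm _ ii).
  have sD : s \in rd_set D by rewrite rdP es.
  by exists (exist _ s sD).
(* [l0] is the default value outside the range, so that the enumeration [e] is a total function. *)
have [l0 _] := ex 0%N ims_gt0.
have ex' i : exists l : rd_idx D, (i < m)%N -> images (val l) = nth [::] ims i.
  by case: (ltnP i m) => [/ex[l el]|_]; [exists l|exists l0].
have [e eE] := boolp.choice ex'.
have im_mem (l : rd_idx D) : images (val l) \in ims by rewrite -rdP; exact: (valP l).
have cjE i j : (i < m)%N -> (j < m)%N ->
    conj_images (nth [::] ims i) (nth [::] ims j) = images (val (iact (val (e i)) (e j))).
  by move=> im jm; rewrite /= images_conj !eE.
apply: (check_skew_sub char0 (e := e) _ _ _ _ _ ck).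
- move=> i j im jm /(congr1 (fun l => images (val l))); rewrite !eE // => /eqP.
  by rewrite nth_uniq // => /eqP.
- move=> l; exists (index (images (val l)) ims); first by rewrite index_mem.
  by apply/val_inj/images_inj; rewrite eE ?index_mem // nth_index.
- by move=> i j im jm; rewrite tabulateE // cjE // index_mem.
- move=> i j im jm; rewrite tabulateE // cjE //.
  by apply/val_inj/images_inj; rewrite eE ?index_mem // nth_index.
- by move=> i j im jm; rewrite tabulateE // chiP ?(valP (e _)) // !eE.
Qed.

End RackCheck.

(** * Certificates *)

(** Ambiguous words, resolved in this order; the resolutions add rules to the quadratic ones. *)
Definition overlaps_O23 : seq (seq nat) :=
  [:: [:: 2; 0; 0]]%N.

(** One step for each conjugacy class of proper subsets, as in the other two certificates. *)
Definition steps_O23 : seq step := [::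
  Step [:: 0; 1] 2
    [:: ([:: 2], [:: 2])]
    [:: ([:: 2; 0], [:: [:: 0; 1]; [:: 1; 2]]); ([:: 2; 1], [:: [:: 1; 0]; [:: 0; 2]]);
        ([:: 2; 2], [::])];
  Step [:: 0] 1
    [:: ([:: 1; 0], [:: 1; 2]); ([:: 1], [:: 1])]
    [:: ([:: 1; 1], [::]); ([:: 1; 0; 0], [::]); ([:: 1; 0; 1], [:: [:: 0; 1; 0]])];
  Step [::] 0
    [:: ([:: 0], [:: 0])]
    [:: ([:: 0; 0], [::])]]%N.

Definition overlaps_O24 : seq (seq nat) :=
  [:: [:: 3; 0; 0]; [:: 4; 0; 0]; [:: 5; 1; 1]; [:: 5; 3; 3]; [:: 3; 2; 0; 2]; [:: 3; 2; 1; 2];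
      [:: 2; 0; 1; 2; 0; 2]; [:: 2; 0; 2; 1; 0; 2]]%N.

Definition steps_O24 : seq step := [::
  Step [:: 0; 1; 2; 3; 4] 5
    [:: ([:: 5], [:: 5])]
    [:: ([:: 5; 0], [:: [:: 0; 5]]); ([:: 5; 1], [:: [:: 1; 2]; [:: 2; 5]]);
        ([:: 5; 2], [:: [:: 2; 1]; [:: 1; 5]]); ([:: 5; 3], [:: [:: 3; 4]; [:: 4; 5]]);
        ([:: 5; 4], [:: [:: 4; 3]; [:: 3; 5]]); ([:: 5; 5], [::])];
  Step [:: 0; 1; 4; 5] 2
    [:: ([:: 2], [:: 2])]
    [:: ([:: 2; 0], [:: [:: 4; 2]; [:: 0; 4]]); ([:: 2; 1], [:: [:: 5; 2]; [:: 1; 5]]);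
        ([:: 2; 4], [:: [:: 0; 2]; [:: 4; 0]]); ([:: 2; 5], [:: [:: 1; 2]; [:: 5; 1]]);
        ([:: 2; 2], [::])];
  Step [:: 0; 1; 2; 3] 4
    [:: ([:: 4; 3], [:: 4; 5]); ([:: 4], [:: 4])]
    [:: ([:: 4; 0], [:: [:: 0; 2]; [:: 2; 4]]); ([:: 4; 1], [:: [:: 1; 4]]);
        ([:: 4; 2], [:: [:: 2; 0]; [:: 0; 4]]); ([:: 4; 4], [::]);
        ([:: 4; 3; 0], [:: [:: 0; 2; 1]; [:: 2; 1; 4]; [:: 1; 4; 3]]);
        ([:: 4; 3; 1], [:: [:: 0; 2; 3]; [:: 1; 0; 2]; [:: 1; 2; 4]; [:: 2; 4; 3]]);
        ([:: 4; 3; 2], [:: [:: 2; 0; 3]; [:: 0; 4; 3]]); ([:: 4; 3; 3], [::]);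
        ([:: 4; 3; 4], [:: [:: 3; 4; 3]])];
  Step [:: 0; 1; 4] 2
    [:: ([:: 2; 1; 0], [:: 2; 5; 3]); ([:: 2; 1], [:: 2; 5]); ([:: 2], [:: 2])]
    [:: ([:: 2; 0], [:: [:: 4; 2]; [:: 0; 4]]); ([:: 2; 4], [:: [:: 0; 2]; [:: 4; 0]]);
        ([:: 2; 2], [::]); ([:: 2; 1; 1], [::]);
        ([:: 2; 1; 4], [:: [:: 0; 2; 1]; [:: 4; 0; 1]]); ([:: 2; 1; 2], [:: [:: 1; 2; 1]]);
        ([:: 2; 1; 0; 0], [::]); ([:: 2; 1; 0; 1], [:: [:: 4; 2; 1; 0]; [:: 0; 1; 4; 0]]);
        ([:: 2; 1; 0; 4], [:: [:: 0; 1; 2; 1]; [:: 4; 0; 1; 2]; [:: 1; 2; 1; 0]]);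
        ([:: 2; 1; 0; 2], [:: [:: 1; 0; 2; 1]; [:: 0; 2; 1; 0]])];
  Step [:: 0; 1; 3] 2
    [:: ([:: 2; 0; 1; 0; 2], [:: 2; 4; 5; 4; 2]); ([:: 2; 0; 1; 0], [:: 2; 4; 5; 4]);
        ([:: 2; 0; 1], [:: 2; 5; 4]); ([:: 2; 0; 3], [:: 2; 4; 5]); ([:: 2; 0], [:: 2; 4]);
        ([:: 2; 1], [:: 2; 5]); ([:: 2], [:: 2])]
    [:: ([:: 2; 3], [:: [:: 3; 2]]); ([:: 2; 2], [::]); ([:: 2; 0; 0], [::]);
        ([:: 2; 0; 2], [:: [:: 0; 2; 0]]); ([:: 2; 1; 0], [:: [:: 2; 0; 3]; [:: 3; 2; 1]]);
        ([:: 2; 1; 1], [::]); ([:: 2; 1; 3], [:: [:: 2; 0; 1]; [:: 3; 2; 0]]);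
        ([:: 2; 1; 2], [:: [:: 1; 2; 1]]); ([:: 2; 0; 1; 1], [::]);
        ([:: 2; 0; 1; 3], [:: [:: 3; 2; 0; 3]]);
        ([:: 2; 0; 1; 2], [:: [:: 0; 1; 2; 0]; [:: 1; 2; 0; 1]]);
        ([:: 2; 0; 3; 0], [:: [:: 3; 2; 0; 3]]); ([:: 2; 0; 3; 1], [:: [:: 2; 0; 1; 0]]);
        ([:: 2; 0; 3; 3], [::]); ([:: 2; 0; 3; 2], [:: [:: 0; 2; 0; 3]]);
        ([:: 2; 0; 1; 0; 0], [::]); ([:: 2; 0; 1; 0; 1], [::]);
        ([:: 2; 0; 1; 0; 3], [:: [:: 3; 2; 0; 1; 0]]);
        ([:: 2; 0; 1; 0; 2; 0], [:: [:: 1; 2; 0; 1; 0; 2]]);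
        ([:: 2; 0; 1; 0; 2; 1], [:: [:: 0; 2; 0; 1; 0; 2]]);
        ([:: 2; 0; 1; 0; 2; 3], [:: [:: 3; 2; 0; 1; 0; 2]]); ([:: 2; 0; 1; 0; 2; 2], [::])];
  Step [:: 0; 1; 2] 3
    [:: ([:: 3], [:: 3])]
    [:: ([:: 3; 0], [:: [:: 0; 1]; [:: 1; 3]]); ([:: 3; 1], [:: [:: 1; 0]; [:: 0; 3]]);
        ([:: 3; 2], [:: [:: 2; 3]]); ([:: 3; 3], [::])];
  Step [:: 0; 5] 1
    [:: ([:: 1; 0; 5; 1], [:: 1; 2; 3; 4]); ([:: 1; 0; 5], [:: 1; 2; 3]);
        ([:: 1; 0], [:: 1; 3]); ([:: 1; 5], [:: 1; 2]); ([:: 1], [:: 1])]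
    [:: ([:: 1; 1], [::]); ([:: 1; 0; 0], [::]); ([:: 1; 0; 1], [:: [:: 0; 1; 0]]);
        ([:: 1; 5; 0], [:: [:: 1; 0; 5]]); ([:: 1; 5; 5], [::]);
        ([:: 1; 5; 1], [:: [:: 5; 1; 5]]); ([:: 1; 0; 5; 0], [::]); ([:: 1; 0; 5; 5], [::]);
        ([:: 1; 0; 5; 1; 0], [:: [:: 5; 1; 0; 5; 1]]);
        ([:: 1; 0; 5; 1; 5], [:: [:: 0; 1; 0; 5; 1]]); ([:: 1; 0; 5; 1; 1], [::])];
  Step [:: 0; 1] 3
    [:: ([:: 3], [:: 3])]
    [:: ([:: 3; 0], [:: [:: 0; 1]; [:: 1; 3]]); ([:: 3; 1], [:: [:: 1; 0]; [:: 0; 3]]);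
        ([:: 3; 3], [::])];
  Step [:: 0] 5
    [:: ([:: 5], [:: 5])]
    [:: ([:: 5; 0], [:: [:: 0; 5]]); ([:: 5; 5], [::])];
  Step [::] 0
    [:: ([:: 0], [:: 0])]
    [:: ([:: 0; 0], [::])]]%N.

Definition overlaps_O44 : seq (seq nat) :=
  [:: [:: 2; 0; 0]; [:: 2; 2; 0]; [:: 3; 3; 0]; [:: 4; 4; 0]; [:: 5; 3; 1]; [:: 3; 1; 0; 1];
      [:: 3; 2; 3; 1]; [:: 4; 3; 2; 0]]%N.

Definition steps_O44 : seq step := [::
  Step [:: 0; 1; 2; 3; 4] 5
    [:: ([:: 5], [:: 5])]
    [:: ([:: 5; 0], [:: [:: 0; 5]]); ([:: 5; 1], [:: [:: 1; 4]; [:: 4; 5]]);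
        ([:: 5; 2], [:: [:: 2; 1]; [:: 1; 5]]); ([:: 5; 3], [:: [:: 3; 2]; [:: 2; 5]]);
        ([:: 5; 4], [:: [:: 4; 3]; [:: 3; 5]]); ([:: 5; 5], [::])];
  Step [:: 0; 1; 3; 5] 2
    [:: ([:: 2], [:: 2])]
    [:: ([:: 2; 0], [:: [:: 0; 1]; [:: 1; 2]]); ([:: 2; 1], [:: [:: 5; 2]; [:: 1; 5]]);
        ([:: 2; 3], [:: [:: 0; 2]; [:: 3; 0]]); ([:: 2; 5], [:: [:: 5; 3]; [:: 3; 2]]);
        ([:: 2; 2], [::])];
  Step [:: 0; 1; 2; 3] 4
    [:: ([:: 4; 3], [:: 4; 5]); ([:: 4], [:: 4])]
    [:: ([:: 4; 0], [:: [:: 0; 3]; [:: 3; 4]]); ([:: 4; 1], [:: [:: 1; 0]; [:: 0; 4]]);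
        ([:: 4; 2], [:: [:: 2; 4]]); ([:: 4; 4], [::]);
        ([:: 4; 3; 0], [:: [:: 0; 3; 2]; [:: 3; 2; 4]; [:: 2; 4; 3]]);
        ([:: 4; 3; 1], [:: [:: 1; 0; 3]; [:: 0; 4; 3]]);
        ([:: 4; 3; 2], [:: [:: 3; 2; 1]; [:: 2; 1; 4]; [:: 1; 4; 3]]); ([:: 4; 3; 3], [::]);
        ([:: 4; 3; 4], [:: [:: 3; 4; 3]])];
  Step [:: 0; 1; 3] 2
    [:: ([:: 2; 1; 0], [:: 2; 5; 4]); ([:: 2; 1], [:: 2; 5]); ([:: 2], [:: 2])]
    [:: ([:: 2; 0], [:: [:: 0; 1]; [:: 1; 2]]); ([:: 2; 3], [:: [:: 0; 2]; [:: 3; 0]]);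
        ([:: 2; 2], [::]); ([:: 2; 1; 1], [::]);
        ([:: 2; 1; 3], [:: [:: 0; 2; 1]; [:: 3; 0; 1]]); ([:: 2; 1; 2], [:: [:: 1; 2; 1]]);
        ([:: 2; 1; 0; 0], [::]); ([:: 2; 1; 0; 1], [:: [:: 1; 2; 1; 0]]);
        ([:: 2; 1; 0; 3], [:: [:: 3; 2; 1; 0]; [:: 1; 0; 3; 2]; [:: 0; 3; 2; 1]]);
        ([:: 2; 1; 0; 2], [:: [:: 1; 0; 2; 1]; [:: 0; 2; 1; 0]])];
  Step [:: 0; 1; 2] 3
    [:: ([:: 3; 2; 1], [:: 3; 5; 4]); ([:: 3; 2], [:: 3; 5]); ([:: 3], [:: 3])]
    [:: ([:: 3; 0], [:: [:: 0; 2]; [:: 2; 3]]); ([:: 3; 1], [:: [:: 1; 3]]); ([:: 3; 3], [::]);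
        ([:: 3; 2; 0], [:: [:: 0; 2; 1]; [:: 2; 1; 3]; [:: 1; 3; 2]]); ([:: 3; 2; 2], [::]);
        ([:: 3; 2; 3], [:: [:: 2; 3; 2]]);
        ([:: 3; 2; 1; 0], [:: [:: 2; 1; 0; 3]; [:: 1; 0; 3; 2]; [:: 0; 3; 2; 1]]);
        ([:: 3; 2; 1; 1], [::]); ([:: 3; 2; 1; 2], [:: [:: 1; 3; 2; 1]]);
        ([:: 3; 2; 1; 3], [:: [:: 2; 3; 2; 1]])];
  Step [:: 0; 5] 1
    [:: ([:: 1; 0; 5; 1], [:: 1; 2; 4; 1]); ([:: 1; 0; 5], [:: 1; 2; 4]);
        ([:: 1; 0], [:: 1; 4]); ([:: 1; 5], [:: 1; 2]); ([:: 1], [:: 1])]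
    [:: ([:: 1; 1], [::]); ([:: 1; 0; 0], [::]); ([:: 1; 0; 1], [:: [:: 0; 1; 0]]);
        ([:: 1; 5; 0], [:: [:: 1; 0; 5]]); ([:: 1; 5; 5], [::]);
        ([:: 1; 5; 1], [:: [:: 5; 1; 5]]); ([:: 1; 0; 5; 0], [::]); ([:: 1; 0; 5; 5], [::]);
        ([:: 1; 0; 5; 1; 0], [:: [:: 5; 1; 0; 5; 1]]);
        ([:: 1; 0; 5; 1; 5], [:: [:: 0; 1; 0; 5; 1]]); ([:: 1; 0; 5; 1; 1], [::])];
  Step [:: 0; 1] 3
    [:: ([:: 3; 0; 1], [:: 3; 2; 5]); ([:: 3; 0], [:: 3; 2]); ([:: 3], [:: 3])]
    [:: ([:: 3; 1], [:: [:: 1; 3]]); ([:: 3; 3], [::]); ([:: 3; 0; 0], [::]);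
        ([:: 3; 0; 3], [:: [:: 0; 3; 0]]); ([:: 3; 0; 1; 0], [:: [:: 1; 3; 0; 1]]);
        ([:: 3; 0; 1; 1], [::]); ([:: 3; 0; 1; 3], [:: [:: 0; 3; 0; 1]])];
  Step [:: 0] 5
    [:: ([:: 5], [:: 5])]
    [:: ([:: 5; 0], [:: [:: 0; 5]]); ([:: 5; 5], [::])];
  Step [::] 0
    [:: ([:: 0], [:: 0])]
    [:: ([:: 0; 0], [::])]]%N.

Lemma check_O23 : rack_check (transpositions 3) (fun _ _ => true) overlaps_O23 steps_O23.
Proof. by vm_compute. Qed.

Lemma check_O24 : rack_check (transpositions 4) (fun _ _ => true) overlaps_O24 steps_O24.
Proof. by vm_compute. Qed.

(** The certificate for the constant cocycle is reused, with the signs found by [rel_ok]. *)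
Lemma check_O24chi : rack_check (transpositions 4) (ord_sign 4) overlaps_O24 steps_O24.
Proof. by vm_compute. Qed.

Lemma check_O44 : rack_check four_cycles (fun _ _ => true) overlaps_O44 steps_O44.
Proof. by vm_compute. Qed.

(** * The four Nichols algebras *)

Section FiniteDimensional.
Variables (k : fieldType) (char0 : [pchar k] =i pred0).

(** Transpositions and 4-cycles are odd, so on these racks the sign cocycle is constantly -1; this
    justifies the constant sign table given to the checker. *)
Lemma sgn_datum_chi n j (s t : 'S_n) : odd_perm t ->
  rd_chi (sgn_datum k n j) s t = (-1) ^+ true.
Proof. by move=> ot; rewrite /= /sgn_chi ot. Qed.

Lemma fd_skew_sub n (D : rack_datum k n) (Y : {set rd_idx D}) b :
  fd_datum D -> (forall l, l \notin Y -> nskew l b = 0) -> nichols_sub Y b.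
Proof.
move=> hD; case: hD Y b => Y b.
- have p : all (perm_eq^~ (iota 0 3)) (transpositions 3) by vm_compute.
  apply: (@rack_check_skew_sub k char0 3 (sgn_datum k 3 2) (transpositions 3) (fun _ _ => true)
    (isT : 0 < size (transpositions 3))%N
    (isT : uniq (transpositions 3)) p (@cycles2_images 3) _ _ _ _ _ check_O23).
  by move=> s t _ /odd_cycles2; exact: sgn_datum_chi.
- have p : all (perm_eq^~ (iota 0 4)) (transpositions 4) by vm_compute.
  apply: (@rack_check_skew_sub k char0 4 (sgn_datum k 4 2) (transpositions 4) (fun _ _ => true)
    (isT : 0 < size (transpositions 4))%N
    (isT : uniq (transpositions 4)) p (@cycles2_images 4) _ _ _ _ _ check_O24).
  by move=> s t _ /odd_cycles2; exact: sgn_datum_chi.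
- have p : all (perm_eq^~ (iota 0 4)) (transpositions 4) by vm_compute.
  apply: (@rack_check_skew_sub k char0 4 (ord_datum k 4) (transpositions 4) (ord_sign 4)
    (isT : 0 < size (transpositions 4))%N
    (isT : uniq (transpositions 4)) p (@cycles2_images 4) _ _ _ _ _ check_O24chi).
  by move=> s t _ _; exact: ord_chi_images.
have p : all (perm_eq^~ (iota 0 4)) four_cycles by vm_compute.
apply: (@rack_check_skew_sub k char0 4 (sgn_datum k 4 4) four_cycles (fun _ _ => true)
    (isT : 0 < size four_cycles)%N
  (isT : uniq four_cycles) p cycles4_images _ _ _ _ _ check_O44).
by move=> s t _ /odd_cycles4; exact: sgn_datum_chi.
Qed.

End FiniteDimensional.

Theorem theorem6p7 (k : closedFieldType) (char0 : [pchar k] =i pred0)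
    (n : nat) (hn : n = 3%N \/ n = 4%N)
    (D : rack_datum k n) (hD : fd_datum D)
    (K : set (boson D)) (Km : nat -> set (boson D))
    (hK : homogeneous_lcs K Km)
    (hK1 : forall x, K x -> exists b : nichols D, x = smash b 1%g) :
  K = gen_subalgebra (Km 1%N) /\
  exists! Y : {set 'S_n}, Y \subset rd_set D /\ K = KY D Y.
Proof. exact: coideal_generated hK hK1 (fun Y b => fd_skew_sub char0 hD). Qed.
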